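(* Let $f\in\mathcal{S}(\mathbb{R}^2;S^2)$ be a symmetric $2$-tensor field. Then $I^qf=0$ for $q=0,1$ if and only if $f=\mathrm{d}^2v$ for some smooth function $v$ on $\mathbb{R}^2$ satisfying $v(x)\to0$ and $\partial_{x_i}v(x)\to0$ as $|x|\to\infty$, for $i=1,2$.
   Context: $\mathcal{S}(\mathbb{R}^2;S^2)$ is the space of symmetric $2$-tensor fields $f=(f_{ij})$ on $\mathbb{R}^2$ with components in the Schwartz space $\mathcal{S}(\mathbb{R}^2)$. $\mathrm{d}^2v$ is the Hessian, $(\mathrm{d}^2v)_{ij}=\partial_{x_i}\partial_{x_j}v$. $T\mathbb{S}^1=\{(x,\xi)\in\mathbb{R}^2\times\mathbb{S}^1:\langle x,\xi\rangle=0\}$. For an integer $q\ge0$, the $q$-th integral moment transform $I^q:\mathcal{S}(\mathbb{R}^2;S^2)\to\mathcal{S}(T\mathbb{S}^1)$ is $$I^qf(x,\xi)=\sum_{i,j=1}^2\int_{-\infty}^{\infty}t^q f_{ij}(x+t\xi)\,\xi_i\xi_j\,dt,\qquad (x,\xi)\in T\mathbb{S}^1.$$ *)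

(* Defs.v *)
From HB Require Import structures.
From mathcomp Require Import all_boot all_order all_algebra.
From mathcomp Require Import all_classical all_reals all_analysis.

Set Implicit Arguments.
Unset Strict Implicit.
Unset Printing Implicit Defensive.

Import Order.TTheory GRing.Theory Num.Theory.
Import numFieldNormedType.Exports.

Local Open Scope classical_set_scope.
Local Open Scope ring_scope.

Definition dot (R : realType) (x y : 'rV[R]_2) : R :=
  \sum_(i < 2) x 0 i * y 0 i.

(* The library norm `|x| on row vectors is the sup norm, hence this one. *)
Definition euclid_norm (R : realType) (x : 'rV[R]_2) : R :=
  Num.sqrt (dot x x).

Definition partial (R : realType) (i : 'I_2) (g : 'rV[R]_2 -> R) :
    'rV[R]_2 -> R :=
  'D_(delta_mx 0 i) g.

(* A multi-index is encoded by the list s of the directions of successive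
   differentiation, the head of s being applied last; all orders of
   differentiation are covered. *)
Definition partials (R : realType) (s : seq 'I_2) (g : 'rV[R]_2 -> R) :
    'rV[R]_2 -> R :=
  foldr (@partial R) g s.

(* Derivability is required explicitly because 'D_v g x is a total operator,
   with a junk value where the directional derivative does not exist. *)
Definition smooth (R : realType) (g : 'rV[R]_2 -> R) : Prop :=
  forall s : seq 'I_2,
    continuous (partials s g) /\
    forall (i : 'I_2) (x : 'rV[R]_2), derivable (partials s g) x (delta_mx 0 i).

Definition schwartz (R : realType) (g : 'rV[R]_2 -> R) : Prop :=
  smooth g /\
  forall (k l : nat) (s : seq 'I_2), exists C : R, forall x : 'rV[R]_2,
    `|x 0 0 ^+ k * x 0 1 ^+ l * partials s g x| <= C.

Definition schwartz_sym_tensor (R : realType) (f : 'rV[R]_2 -> 'M[R]_2) : Prop :=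
  (forall x, (f x)^T = f x) /\
  (forall i j : 'I_2, schwartz (fun x => f x i j)).

Definition hessian (R : realType) (v : 'rV[R]_2 -> R) (x : 'rV[R]_2) : 'M[R]_2 :=
  \matrix_(i < 2, j < 2) partial i (partial j v) x.

Definition TS1 (R : realType) : set ('rV[R]_2 * 'rV[R]_2) :=
  [set p | euclid_norm p.2 = 1 /\ dot p.1 p.2 = 0].

(* Extended to all pairs (x, xi); only its values on TS1 are meaningful. *)
Definition moment_transform (R : realType) (q : nat)
    (f : 'rV[R]_2 -> 'M[R]_2) (p : 'rV[R]_2 * 'rV[R]_2) : R :=
  \sum_(i < 2) \sum_(j < 2)
    \int[lebesgue_measure]_(t in [set: R])
      (t ^+ q * f (p.1 + t *: p.2) i j * p.2 0 i * p.2 0 j).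

Definition vanishes_at_infinity (R : realType) (g : 'rV[R]_2 -> R) : Prop :=
  forall e : R, 0 < e -> exists M : R, forall x : 'rV[R]_2,
    M <= euclid_norm x -> `|g x| < e.

(* Main.v *)
Require Import Defs.
From HB Require Import structures.
From mathcomp Require Import all_boot all_order all_algebra.
From mathcomp Require Import all_classical all_reals all_analysis.
From mathcomp Require Import measurable_realfun ring lra.

Set Implicit Arguments.
Unset Strict Implicit.
Unset Printing Implicit Defensive.

Import Order.TTheory GRing.Theory Num.Theory.
Import numFieldNormedType.Exports.

Local Open Scope classical_set_scope.
Local Open Scope ring_scope.

(** The functions below are written in coordinates, with pt x y the point
    (x, y); the coordinates 1 and 2 of this overview are the indices 0 and 1
    of the code.  A non-horizontal line is t |-> pt (s - a t) t, with slope
    parameter a and abscissa s; T k g s a denotes the integral of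
    t^k g (s - a t, t) over t in R, for a Schwartz function g.

    From vanishing moments to a potential. An affine reparametrization of
    lines turns I^0 f = I^1 f = 0 into the two families of equations a^2 T k
    f_11 - 2 a T k f_12 + T k f_22 = 0, k = 0, 1, for all s and a
    (slope_equation). Now d/da (T 0 g) = - T 1 (d_1 g) and d/ds (T 1 g) = T 1
    (d_1 g); so, in the a-derivative of the equation for k = 0, the terms in
    which a moment is differentiated form, up to sign, the s-derivative of the
    equation for k = 1, and vanish. What is left is T 0 f_12 = a T 0 f_11, and
    then T 0 f_22 = a T 0 f_12 (slope_moment_equations). Since T 0 (d_2 g) = a
    T 0 (d_1 g), differentiating in s says that d_2 f_11 - d_1 f_12 and d_2
    f_12 - d_1 f_22 have vanishing integrals over all non-horizontal lines,
    hence are zero by injectivity of the X-ray transform (xray_injective).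

    Both rows of f are thus closed Schwartz 1-forms.  A closed Schwartz 1-form
    g dx + h dy is the differential of the Schwartz function
    U (x, y) = int_(-oo)^x g (s, y) ds (closed_schwartz_form_exact): the total
    integral of g over a horizontal line does not depend on the line, so it is
    zero, and U may also be computed from +oo, which gives its decay.  Applied
    to the two rows of f, this yields U_1 and U_2 with d_2 U_1 = f_12 =
    d_1 U_2; applied to (U_1, U_2) it yields v with f = d^2 v, and v and its
    gradient are Schwartz functions.

    Injectivity of the X-ray transform.  If w has zero integral over every
    non-horizontal line, Fubini's theorem and the shear x = s - a t give
    int int w (x, t) cos (xi x + eta t + c) dx dt = 0 whenever xi <> 0.  Two
    applications of the one-dimensional statement cos_transform_injective then
    give w = 0.  That statement is proved with the Fejer kernel
    k (u) = int_0^1 (1 - xi) cos (xi u) dxi = (1 - cos u) / u^2, which is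
    nonnegative, integrable and not almost everywhere zero: if all the
    integrals int h (t) cos (eta t + c) dt with eta <> 0 vanish, then
    int h (e u + t0) k (u) du = 0 for all e > 0, and e -> 0 gives
    h (t0) int k = 0.

    From a potential to vanishing moments.  Along a line, f = d^2 v contracts
    to phi'' with phi (t) = v (x + t xi), and t phi'' is the derivative of
    t phi' - phi.  Since phi'' decays rapidly and phi' -> 0, also t phi' -> 0
    (weighted_primitive_tends0), so phi'' and t phi'' integrate to zero
    (Rintegral_derive). *)

(** * Integration on the line against the Cauchy density *)

Section Line_integrals.
Context {R : realType}.
Implicit Types (f g h F : R -> R) (B : set R) (a b c x y t K : R).
Local Notation mu := (@lebesgue_measure R).

(** The function 1 / (1 + t^2), integrable on the line.  Every integrand below
    is bounded by a multiple K of it, which makes all dominations uniform. *)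
Definition cauchy_density t : R := (1 + t ^+ 2)^-1.
Local Notation d := cauchy_density.

Lemma add1sqr_gt0 x : 0 < 1 + x ^+ 2.
Proof. by have := sqr_ge0 x; lra. Qed.

Lemma cauchy_density_gt0 t : 0 < d t.
Proof. by rewrite invr_gt0 add1sqr_gt0. Qed.

Lemma cauchy_density_ge0 t : 0 <= d t.
Proof. by rewrite ltW// cauchy_density_gt0. Qed.

Lemma cauchy_density_le1 t : d t <= 1.
Proof. exact: oneDsqrV_le1. Qed.

Lemma continuous_cauchy_density : continuous d.
Proof. exact: continuous_oneDsqrV. Qed.

Lemma le_density_sqr K (r : R) t : `|r| <= K * d t * d t -> `|r| <= K * d t.
Proof.
move=> H; have d0 := cauchy_density_gt0 t; apply: le_trans (H) _.
rewrite -[leRHS]mulr1 ler_wpM2l ?cauchy_density_le1// -(pmulr_lge0 _ d0).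
by apply: le_trans H.
Qed.

(** A constant K for which K d dominates some function is nonnegative. *)
Lemma le_density_cst_ge0 K f : (forall t, `|f t| <= K * d t) -> 0 <= K.
Proof.
by move=> /(_ 0) /(le_trans (normr_ge0 _));
  rewrite pmulr_lge0// cauchy_density_gt0.
Qed.

Lemma integrable_cauchy_density B : measurable B ->
  mu.-integrable B (EFin \o d).
Proof.
move=> mB.
suff H : mu.-integrable setT (EFin \o d).
  by apply: (@integrableS _ _ _ mu setT B (EFin \o d) measurableT mB) H.
apply/integrableP; split.
  apply/measurable_EFinP; apply: continuous_measurable_fun.
  exact: continuous_cauchy_density.
have -> : (\int[mu]_x `|(d x)%:E| = \int[mu]_x (d x)%:E)%E.
  apply: eq_integral => x _.
  by rewrite /= ger0_norm// ltW// cauchy_density_gt0.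
rewrite ge0_symfun_integralT; first last.
- by move=> x /=; rewrite /cauchy_density sqrrN.
- exact: continuous_cauchy_density.
- by move=> x; rewrite ltW// cauchy_density_gt0.
have -> : [set x : R | 0 <= x] = `[0, +oo[%classic.
  by apply/seteqP; split => x /=; rewrite in_itv /= andbT.
by rewrite [X in (_ * X)%E]integral0y_oneDsqr -EFinM ltry.
Qed.

Lemma integrable_scale B c f : measurable B -> mu.-integrable B (EFin \o f) ->
  mu.-integrable B (EFin \o (fun t => c * f t)).
Proof.
move=> mB fi; rewrite (_ : _ \o _ = fun x => (c%:E * (EFin \o f) x)%E).
  exact: integrableZl.
by apply/funext => t; rewrite /= EFinM.
Qed.

Lemma integrable_add B f g : measurable B -> mu.-integrable B (EFin \o f) ->
  mu.-integrable B (EFin \o g) ->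
    mu.-integrable B (EFin \o (fun t => f t + g t)).
Proof.
move=> mB fi gi; rewrite (_ : _ \o _ = (EFin \o f) \+ (EFin \o g))%E.
  exact: integrableD.
by apply/funext => t; rewrite /= EFinD.
Qed.

(** The integral of 1 / (1 + t^2) over the line; only its finiteness and its
    sign are used, never its value pi. *)
Definition cauchy_mass : R := \int[mu]_(t in setT) d t.

Lemma cauchy_mass_ge0 : 0 <= cauchy_mass.
Proof. by apply: Rintegral_ge0 => t _; rewrite ltW// cauchy_density_gt0. Qed.

Lemma integrable_le_density K f B : measurable B -> measurable_fun setT f ->
  (forall t, B t -> `|f t| <= K * d t) -> mu.-integrable B (EFin \o f).
Proof.
move=> mB mf fK;
  apply: (@le_integrable _ _ _ mu _ mB _ (EFin \o (fun t => K * d t))).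
- by apply/measurable_EFinP; apply: measurable_funS mf.
- move=> t Bt; rewrite lee_fin; apply: le_trans (fK t Bt) _; exact: ler_norm.
- by apply: integrable_scale => //; exact: integrable_cauchy_density.
Qed.

(** The weight c is typically a power of the endpoint of B; keeping it next to
    the integrand transfers pointwise decay to the integral. *)
Lemma Rintegral_le_density K f B c : measurable B -> 0 <= K -> 0 <= c ->
  mu.-integrable B (EFin \o f) ->
  (forall t, B t -> c * `|f t| <= K * d t) ->
  c * `|\int[mu]_(t in B) f t| <= K * cauchy_mass.
Proof.
move=> mB K0 c0 fi fK.
have di := integrable_cauchy_density mB.
have ni : mu.-integrable B (EFin \o (fun t => `|f t|)) by exact: integrable_abse
  fi.
apply: (@le_trans _ _ (c * \int[mu]_(t in B) `|f t|)).
  by rewrite ler_wpM2l// le_normr_Rintegral.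
rewrite -RintegralZl//.
apply: (@le_trans _ _ (\int[mu]_(t in B) (K * d t))).
  apply: le_Rintegral => //.
  - exact: integrable_scale.
  - exact: integrable_scale.
rewrite RintegralZl// ler_wpM2l// /cauchy_mass.
rewrite /Rintegral fine_le//; last first.
- apply: ge0_subset_integral => //.
    apply/measurable_EFinP; apply: continuous_measurable_fun.
    exact: continuous_cauchy_density.
  by move=> t _; rewrite lee_fin ltW// cauchy_density_gt0.
- by apply: integrable_fin_num => //; exact: integrable_cauchy_density.
- exact: integrable_fin_num.
Qed.

(** Continuity of an integral depending on a parameter, under a domination
    which is uniform in the parameter. *)
Lemma continuous_Rintegral_param K (f : R -> R -> R) B : measurable B ->
  (forall x, measurable_fun setT (f x)) ->
  (forall t, continuous (f ^~ t)) ->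
  (forall x t, `|f x t| <= K * d t) ->
  continuous (fun x => \int[mu]_(t in B) f x t).
Proof.
move=> mB mf cf fK x.
have xI : x \in `]x - 1, x + 1[%classic by rewrite inE /= in_itv /=; lra.
apply: (@continuity_under_integral R _ _ mu f B mB (x - 1) (x + 1) _ _
   (fun t => K * d t)) => //.
- by move=> y _; apply: (@integrable_le_density K).
- by apply: aeW => t _ y _; exact: cf.
- apply: (@integrable_le_density K) => //.
    apply: measurable_funM => //.
    by apply: continuous_measurable_fun; exact: continuous_cauchy_density.
  move=> t _; rewrite ger0_norm //; apply: le_trans (fK x t); exact: normr_ge0.
- by move=> y _; apply: aeW => t _; exact: fK.
Qed.

(** Differentiation under the integral sign, under the same uniform
    domination. *)
Lemma is_derive_Rintegral_param K (f f' : R -> R -> R) B x : measurable B ->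
  (forall x, measurable_fun setT (f x)) ->
  (forall x t, is_derive x 1 (f ^~ t) (f' x t)) ->
  (forall x t, `|f x t| <= K * d t) ->
  (forall x t, `|f' x t| <= K * d t) ->
  is_derive x 1 (fun x => \int[mu]_(t in B) f x t) (\int[mu]_(t in B) f' x t).
Proof.
move=> mB mf df fK f'K.
have xI : `]x - 1, x + 1[%classic x by rewrite /= in_itv /=; lra.
have pE y t : partial1of2 f y t = f' y t by rewrite partial1of2E; have [] :=
  df y t.
have K0 t : 0 <= K * d t by apply: le_trans (fK x t); exact: normr_ge0.
have iK : mu.-integrable B (EFin \o (fun t => K * d t)).
  apply: (@integrable_le_density K) => //.
    apply: measurable_funM => //.
    by apply: continuous_measurable_fun; exact: continuous_cauchy_density.
  by move=> t _; rewrite ger0_norm.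
have fi y : `]x - 1, x + 1[%classic y -> mu.-integrable B (EFin \o f y).
  by move=> _; apply: (@integrable_le_density K).
have fd y t : `]x - 1, x + 1[%classic y -> B t -> derivable (f ^~ t) y 1.
  by move=> _ _; have [] := df y t.
have fb y t : `]x - 1,
  x + 1[%classic y -> B t -> `|partial1of2 f y t| <= K * d t.
  by move=> _ _; rewrite pE.
apply: DeriveDef.
  exact: (@derivable_under_integral R _ _ mu f B mB x _ _ xI fi fd _ K0 iK fb).
rewrite -derive1E (@differentiation_under_integral R _ _ mu f B mB x _ _ xI fi
  fd _ K0 iK fb).
by apply: eq_Rintegral => t _; rewrite pE.
Qed.

End Line_integrals.

(** * Substitution and the fundamental theorem of calculus on the line *)

Section Line_calculus.
Context {R : realType}.
Implicit Types (f g h F : R -> R) (B : set R) (a b c x y t K : R).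
Local Notation mu := (@lebesgue_measure R).
Local Notation d := cauchy_density.

Lemma cauchy_density_affine a b t : a != 0 ->
  d (a * t + b) <= (1 + 2 * (b ^+ 2 + 1) / a ^+ 2) * d t.
Proof.
move=> a0; rewrite /cauchy_density ler_pdivlMr ?add1sqr_gt0//.
rewrite mulrC ler_pdivrMr ?add1sqr_gt0//.
have [u ->] : exists u, t = (u - b) / a by exists (a * t + b); field.
have -> : a * ((u - b) / a) + b = u by field.
have ai : 0 < a ^+ 2 by rewrite exprn_even_gt0.
have {ai} : 0 < (a ^+ 2)^-1 by rewrite invr_gt0.
rewrite exprMn exprVn; set i := _^-1 => i0.
have : 0 <= i * (2 * b ^+ 2 * u ^+ 2 + (u + b) ^+ 2 + 2).
  apply: mulr_ge0; first exact: ltW.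
  by have := sqr_ge0 (b * u); have := sqr_ge0 (u + b); rewrite exprMn; lra.
have := sqr_ge0 u; nra.
Qed.

Let is_derive_affine a b t : is_derive t 1 (fun t => a * t + b) a.
Proof.
by apply: is_derive_eq; rewrite /GRing.scale /= mulr1 addr0.
Qed.

Lemma continuous_affine a b : continuous (fun t => a * t + b).
Proof.
move=> t; apply: cvgD; last exact: cvg_cst.
by apply: cvgM; [exact: cvg_cst|exact: cvg_id].
Qed.

Let ge0_Rintegral_affine a b f : 0 < a -> continuous f ->
  (forall t, 0 <= f t) ->
  \int[mu]_(t in setT) f t = \int[mu]_(t in setT) (f (a * t + b) * a).
Proof.
move=> a0 cf f0.
have dF : (fun t => a * t + b)^`()%classic = cst a.
  by apply/funext => t; rewrite derive1E; have [] := is_derive_affine a b t.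
rewrite /Rintegral; congr fine.
have := (@increasing_ge0_integration_by_substitutionT R (fun t => a * t + b) f
  _ _ _ _ _ _ _ cf f0).
rewrite dF; apply.
- by move=> x y xy; rewrite ltrD2r ltr_pM2l.
- by move=> x; exact: cvg_cst.
- exact: is_cvg_cst.
- exact: is_cvg_cst.
- by move=> x; have [] := is_derive_affine a b x.
- apply/cvgrNyPle => A.
  exists ((A - b) / a); split; first exact: num_real.
  by move=> x; rewrite ltr_pdivlMr// mulrC => /ltW; rewrite lerBrDr.
- apply/cvgryPge => A.
  exists ((A - b) / a); split; first exact: num_real.
  by move=> x; rewrite ltr_pdivrMr// mulrC => /ltW; rewrite lerBlDr.
Qed.

(** Affine substitution for functions of any sign.  Substitution being known
    for nonnegative continuous functions, it is applied to f + K d and to K d,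
    which are both nonnegative. *)
Lemma Rintegral_affine K a b f : 0 < a -> continuous f ->
  (forall t, `|f t| <= K * d t) ->
  \int[mu]_(t in setT) f t = a * \int[mu]_(t in setT) f (a * t + b).
Proof.
move=> a0 cf fK.
have cd := @continuous_cauchy_density R.
have K0 : 0 <= K by exact: le_density_cst_ge0 fK.
have ccomp g : continuous g -> continuous (fun t => g (a * t + b)).
  by move=> cg t; apply: continuous_comp; [exact: continuous_affine|exact: cg].
have cKd : continuous (fun t => K * d t).
  by move=> t; apply: cvgM; [exact: cvg_cst|exact: cd].
have cfd : continuous (fun t => f t + K * d t).
  by move=> t; apply: cvgD; [exact: cf|exact: cKd].
have i1 g : continuous g -> (forall t, `|g t| <= K * d t) ->
  mu.-integrable setT (EFin \o g).
  by move=> cg gK; apply: (@integrable_le_density _ K) => //;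
    exact: continuous_measurable_fun.
have i2 g : continuous g -> (forall t, `|g t| <= K * d t) ->
    mu.-integrable setT (EFin \o (fun t => g (a * t + b))).
  move=> cg gK.
  apply: (@integrable_le_density _ (K * (1 + 2 * (b ^+ 2 + 1) / a ^+ 2))) => //.
    by apply: continuous_measurable_fun; exact: ccomp.
  move=> t _; apply: le_trans (gK _) _; rewrite -mulrA ler_wpM2l//.
  by apply: cauchy_density_affine; rewrite gt_eqF.
have Kd t : `|K * d t| <= K * d t.
  by rewrite ger0_norm// mulr_ge0// ltW// cauchy_density_gt0.
have := @ge0_Rintegral_affine a b (fun t => K * d t) a0 cKd _.
have := @ge0_Rintegral_affine a b (fun t => f t + K * d t) a0 cfd _.
have i3 g : mu.-integrable setT (EFin \o g) ->
  \int[mu]_(t in setT) (g t * a) = a * \int[mu]_(t in setT) g t.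
  by move=> ig; rewrite -RintegralZl//; apply: eq_Rintegral => t _;
    rewrite mulrC.
rewrite (@i3 (fun t => f (a * t + b) + K * d (a * t + b))); last first.
  by apply: integrable_add => //; [exact: i2|exact: (i2 (fun t => K * d t))].
rewrite (@i3 (fun t => K * d (a * t + b))); last exact: (i2 (fun t => K * d t)).
rewrite RintegralD//; [|exact: i1|exact: i1].
rewrite RintegralD//; [|exact: i2|exact: (i2 (fun t => K * d t))].
have f0 t : 0 <= f t + K * d t by have := fK t; rewrite ler_norml; lra.
have d0 t : 0 <= K * d t by rewrite mulr_ge0// ltW// cauchy_density_gt0.
move=> /(_ f0) H1 /(_ d0) H2; lra.
Qed.

(** f (t) tends to 0 when t tends to +oo and when t tends to -oo. *)
Definition tends0_infty f := forall e, 0 < e -> exists M, forall t, M <= `|t| ->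
  `|f t| < e.

Lemma expr_le_add1sqr k t : `|t| ^+ k <= (1 + t ^+ 2) ^+ k.
Proof.
apply: lerXn2r; rewrite ?nnegrE ?normr_ge0 ?ltW ?add1sqr_gt0//.
have := sqr_ge0 (`|t| - 1); rewrite -(real_normK (num_real t)).
have := sqr_ge0 `|t|; nra.
Qed.

Lemma tends0_of_bound (f : R -> R) C : (forall t, `|t| * `|f t| <= C) ->
  tends0_infty f.
Proof.
move=> H e e0; exists (C / e + 1) => t Ht.
have C0 : 0 <= C by apply: le_trans (H 0); rewrite normr0 mul0r.
have q0 : 0 <= C / e by rewrite divr_ge0// ltW.
have t0 : 0 < `|t| by apply: lt_le_trans Ht; rewrite ltr_wpDl.
rewrite -(ltr_pM2l t0); apply: le_lt_trans (H t) _.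
by rewrite -ltr_pdivrMr//; apply: lt_le_trans Ht; rewrite ltrDl.
Qed.

Lemma tends0_of_density (f : R -> R) K : 0 <= K ->
  (forall t, `|f t| <= K * d t) -> tends0_infty f.
Proof.
move=> K0 H; apply: (@tends0_of_bound _ K) => t.
apply: (@le_trans _ _ (`|t| * (K * d t))); first by rewrite ler_wpM2l.
rewrite mulrCA -[leRHS]mulr1 ler_wpM2l// /cauchy_density ler_pdivrMr
  ?add1sqr_gt0//.
by have := expr_le_add1sqr 1 t; rewrite !expr1 mul1r.
Qed.

Lemma tends0_infty_scale f c : tends0_infty f ->
  tends0_infty (fun t => c * f t).
Proof.
move=> f0 e e0; have c1 : 0 < `|c| + 1 by rewrite ltr_wpDl.
have [M HM] := f0 (e / (`|c| + 1)) (divr_gt0 e0 c1); exists M => t /HM ft.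
rewrite normrM; apply: (@le_lt_trans _ _ ((`|c| + 1) * `|f t|)).
  by rewrite ler_wpM2r// lerDl.
by rewrite mulrC -ltr_pdivlMr.
Qed.

Lemma tends0_infty_add f g : tends0_infty f -> tends0_infty g ->
  tends0_infty (fun t => f t + g t).
Proof.
move=> f0 g0 e e0; have e2 : 0 < e / 2 by rewrite divr_gt0.
have [M1 HM1] := f0 _ e2; have [M2 HM2] := g0 _ e2.
exists (Num.max M1 M2) => t; rewrite ge_max => /andP[/HM1 h1 /HM2 h2].
by apply: le_lt_trans (ler_normD _ _) _; lra.
Qed.

(** A function tending to 0 and taking the value c arbitrarily far is such that
    c = 0; no side of infinity is prescribed. *)
Lemma tends0_infty_eq0 f c : tends0_infty f ->
  (forall M, exists2 t, M <= `|t| & f t = c) -> c = 0.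
Proof.
move=> f0 fc; apply/eqP; rewrite -normr_le0; apply/ler_addgt0Pl => e e0.
have [M HM] := f0 e e0; have [t Mt <-] := fc M.
by rewrite addr0; exact/ltW/HM.
Qed.

Lemma is_derive_integralNy K f x : continuous f ->
  (forall t, `|f t| <= K * d t) ->
  is_derive x 1 (fun x => \int[mu]_(t in `]-oo, x]) f t) (f x).
Proof.
move=> cf fK.
have xx : x < x + 1 by lra.
have fi : mu.-integrable `]-oo, x + 1] (EFin \o f).
  apply: (@integrable_le_density _ K) => //.
  exact: continuous_measurable_fun.
have [dP1 dP2] := @continuous_FTC1 R f -oo%O x (x + 1) xx fi (ltNyr x) (cf x).
by apply: DeriveDef; [exact: dP1|rewrite -derive1E; exact: dP2].
Qed.

(** A primitive F of f which tends to 0 is the integral of f from -oo.  Both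
    sides have derivative f, so their difference is a constant, and both tend
    to 0 at -oo: for the integral this is the bound |x P (x)| <= K int d, which
    is where the square of the density is needed. *)
Lemma primitiveNy K F f x : continuous f ->
  (forall t, `|f t| <= K * d t * d t) ->
  (forall t, is_derive t 1 F (f t)) -> tends0_infty F ->
  \int[mu]_(t in `]-oo, x]) f t = F x.
Proof.
move=> cf fK dF F0.
have fK1 : forall t, `|f t| <= K * d t by move=> t; exact: le_density_sqr.
have K0 : 0 <= K by exact: le_density_cst_ge0 fK1.
have fi (B : set R) : measurable B -> mu.-integrable B (EFin \o f).
  move=> mB; apply: (@integrable_le_density _ K) => //.
  exact: continuous_measurable_fun.
pose P x := \int[mu]_(t in `]-oo, x]) f t.
have dP y : is_derive y 1 P (f y).
  exact: (@is_derive_integralNy K).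
have PF y : P y - F y = P x - F x.
  apply: (@is_derive_0_is_cst _ (fun y => P y - F y)) => z.
  by apply: is_derive_eq; rewrite subrr.
have Pb y : y <= 0 -> `|y| * `|P y| <= K * cauchy_mass.
  move=> y0; apply: Rintegral_le_density => //.
    exact: fi.
  move=> t /=; rewrite in_itv /= => ty.
  have H : `|y| * d t <= 1.
    rewrite ler_pdivrMr; last by nra.
    rewrite mul1r ler0_norm//; nra.
  have H1 := cauchy_density_gt0 t; have H2 := fK t.
  apply: (@le_trans _ _ (`|y| * (K * d t * d t))); first by rewrite ler_wpM2l.
  have -> : `|y| * (K * d t * d t) = (K * d t) * (`|y| * d t) by ring.
  by rewrite -[leRHS]mulr1 ler_wpM2l// mulr_ge0// ltW.
have G0 : tends0_infty (fun y => (if y <= 0 then P y else 0) + -1 * F y).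
  apply: tends0_infty_add; last exact: tends0_infty_scale.
  apply: (@tends0_of_bound _ (K * cauchy_mass)) => y.
  case: ifPn => [|_]; first exact: Pb.
  by rewrite normr0 mulr0 mulr_ge0// cauchy_mass_ge0.
apply/eqP; rewrite -subr_eq0 -/(P x); apply/eqP.
apply: (tends0_infty_eq0 G0) => M; exists (- `|M|).
  by rewrite normrN normr_id ler_norm.
by rewrite oppr_le0 normr_ge0 mulN1r PF.
Qed.

Lemma Rintegral_compl K f x : continuous f -> (forall t, `|f t| <= K * d t) ->
  \int[mu]_(t in setT) f t =
  \int[mu]_(t in `]-oo, x]) f t + \int[mu]_(t in `]x, +oo[) f t.
Proof.
move=> cf fK.
rewrite -Rintegral_setU//.
- by rewrite -setCitvl setUv.
- by apply: (@integrable_le_density _ K) => //;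
    [exact: measurableU|exact: continuous_measurable_fun].
- rewrite disj_set2E; apply/eqP; rewrite -subset0 => t /=.
  by rewrite !in_itv /= andbT => -[]; lra.
Qed.

(** The integral over the line of the derivative of a function tending to 0 on
    both sides is zero. *)
Lemma Rintegral_derive K F f : continuous f ->
  (forall t, `|f t| <= K * d t * d t) ->
  (forall t, is_derive t 1 F (f t)) -> tends0_infty F ->
  \int[mu]_(t in setT) f t = 0.
Proof.
move=> cf fK dF F0.
have fK1 : forall t, `|f t| <= K * d t by move=> t; exact: le_density_sqr.
have K0 : 0 <= K by exact: le_density_cst_ge0 fK1.
have fi (B : set R) : measurable B -> mu.-integrable B (EFin \o f).
  move=> mB; apply: (@integrable_le_density _ K) => //.
  exact: continuous_measurable_fun.
pose Q x := \int[mu]_(t in `]x, +oo[) f t.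
have E x : \int[mu]_(t in setT) f t = F x + Q x.
  by rewrite (@Rintegral_compl K _ x)// (@primitiveNy K F).
have Qb y : 0 <= y -> y * `|Q y| <= K * cauchy_mass.
  move=> y0; apply: Rintegral_le_density => //.
    exact: fi.
  move=> t /=; rewrite in_itv /= andbT => ty.
  have H : y * d t <= 1.
    rewrite ler_pdivrMr; last by nra.
    rewrite mul1r; nra.
  have H1 := cauchy_density_gt0 t; have H2 := fK t.
  apply: (@le_trans _ _ (y * (K * d t * d t))); first by rewrite ler_wpM2l.
  have -> : y * (K * d t * d t) = (K * d t) * (y * d t) by ring.
  by rewrite -[leRHS]mulr1 ler_wpM2l// mulr_ge0// ltW.
have G0 : tends0_infty (fun y => F y + (if 0 <= y then Q y else 0)).
  apply: tends0_infty_add => //.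
  apply: (@tends0_of_bound _ (K * cauchy_mass)) => y.
  case: ifPn => [y0|_]; first by rewrite (ger0_norm y0); exact: Qb.
  by rewrite normr0 mulr0 mulr_ge0// cauchy_mass_ge0.
apply: (tends0_infty_eq0 G0) => M; exists `|M|.
  by rewrite normr_id ler_norm.
by rewrite normr_ge0 -E.
Qed.

End Line_calculus.

(** * Exchange of integrals in the plane *)

Section Plane_Fubini.
Context {R : realType}.
Local Notation mu := (@lebesgue_measure R).
Local Notation d := cauchy_density.
Local Notation mR := (measurableTypeR R).

(** An open set of the plane is the union of the boxes with rational centres
    and radii 1 / (n + 1) that it contains, hence belongs to the product
    sigma-algebra. *)
Lemma open_plane_measurable (O : set (R * R)) : open O ->
  measurable (O : set (mR * mR)).
Proof.
move=> oO.
pose box (k : rat * rat * nat) : set (mR * mR) :=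
  `](ratr k.1.1 : R) - k.2.+1%:R^-1, ratr k.1.1 + k.2.+1%:R^-1[ `*`
  `](ratr k.1.2 : R) - k.2.+1%:R^-1, ratr k.1.2 + k.2.+1%:R^-1[.
pose F k := if pselect (box k `<=` O) then box k else set0.
have -> : O = \bigcup_k F k.
  apply/seteqP; split => [[x y] Oxy|z [k _]]; last first.
    by rewrite /F; case: pselect => // kO; exact: kO.
  have /nbhs_ballP[e /= e0 eO] := open_nbhs_nbhs (conj oO Oxy).
  have e2 : 0 < e / 2 by rewrite divr_gt0.
  have [n] := ltr_add_invr e2; rewrite add0r; set r := _^-1 => re.
  have r0 : 0 < r by rewrite invr_gt0.
  have [p pr] : exists p : rat, ratr p \in `](x - r), (x + r)[.
    by apply: rat_in_itvoo; lra.
  have [q qr] : exists q : rat, ratr q \in `](y - r), (y + r)[.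
    by apply: rat_in_itvoo; lra.
  move: pr qr; rewrite !in_itv /= => /andP[p1 p2] /andP[q1 q2].
  have bO : box (p, q, n) `<=` O.
    move=> [u v] [/= ur vr]; move: ur vr.
    rewrite !in_itv /= -/r => /andP[u1 u2] /andP[v1 v2].
    by apply: eO; split; rewrite /ball /= ltr_norml; apply/andP; split; lra.
  exists (p, q, n) => //; rewrite /F; case: pselect => // ?.
  by split; rewrite /= in_itv /= -/r; apply/andP; split; lra.
apply: countable_bigcupT_measurable; first exact: countableP.
move=> k; rewrite /F; case: pselect => ?; last exact: measurable0.
by apply: measurableX; exact: measurable_itv.
Qed.

Lemma continuous_plane_measurable (G : R * R -> R) : continuous G ->
  measurable_fun setT (G : mR * mR -> mR).
Proof.
move=> /continuousP cG.
apply: (measurability _ (RGenOpens.measurableE R)) => _ [_ [a [b ->] <-]].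
rewrite setTI; apply: open_plane_measurable; apply: cG; exact: interval_open.
Qed.

Lemma continuous_curry_l (G : R -> R -> R) s :
  continuous (fun z : R * R => G z.1 z.2) -> continuous (G s).
Proof.
move=> cG t.
by apply: (@continuous2_cvg _ R R R _ _ (fun=> s) id G s t (cG (s, t)));
  [exact: cvg_cst|exact: cvg_id].
Qed.

Lemma continuous_curry_r (G : R -> R -> R) t :
  continuous (fun z : R * R => G z.1 z.2) -> continuous (G ^~ t).
Proof.
move=> cG s.
by apply: (@continuous2_cvg _ R R R _ _ id (fun=> t) G s t (cG (s, t)));
  [exact: cvg_id|exact: cvg_cst].
Qed.

(** Fubini's theorem for continuous functions of rapid decay.  The factor f,
    only measurable, allows integration over a part of the line in the first
    variable. *)
Lemma Rintegral_exchange K (f : R -> R) (G : R -> R -> R) :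
  measurable_fun setT f -> continuous (fun z : R * R => G z.1 z.2) ->
  (forall s t, `|f s * G s t| <= K * d s * d t) ->
  \int[mu]_(s in setT) (\int[mu]_(t in setT) (f s * G s t)) =
  \int[mu]_(t in setT) (\int[mu]_(s in setT) (f s * G s t)).
Proof.
move=> mf cG GK.
have K0 : 0 <= K.
  have := le_trans (normr_ge0 _) (GK 0 0); rewrite !pmulr_lge0//;
    exact: cauchy_density_gt0.
pose H (z : mR * mR) := (f z.1 * G z.1 z.2)%:E.
have mH : measurable_fun setT H.
  apply/measurable_EFinP; apply: measurable_funM.
    by apply: measurableT_comp => //; exact: measurable_fst.
  exact: continuous_plane_measurable.
have mH1 s : measurable_fun setT (fun t : R => f s * G s t).
  by apply: measurable_funM => //; apply: continuous_measurable_fun;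
    exact: continuous_curry_l.
have mH2 t : measurable_fun setT (fun s : R => f s * G s t).
  apply: measurable_funM => //; apply: continuous_measurable_fun.
  exact: (@continuous_curry_r G).
have i1 s : mu.-integrable setT (EFin \o (fun t : R => f s * G s t)).
  by apply: (@integrable_le_density _ (K * d s)).
have i2 t : mu.-integrable setT (EFin \o (fun s : R => f s * G s t)).
  apply: (@integrable_le_density _ (K * d t)) => // s _.
  by apply: le_trans (GK s t) _; rewrite mulrAC.
have dge0 s : 0 <= d s :> R by rewrite ltW// cauchy_density_gt0.
have iH : (mu \x mu)%E.-integrable setT H.
  apply/integrable12ltyP => //.
  have inner s : (\int[mu]_y `|H (s, y)| <= ((K * cauchy_mass) * d s)%:E)%E.
    have n1 : mu.-integrable setT (EFin \o (fun t : R => `|f s * G s t|)).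
      exact: integrable_abse (i1 s).
    rewrite (_ : (\int[mu]_y _)%E = (\int[mu]_(y in setT) `|f s * G s y|)%:E);
      last first.
      by rewrite /Rintegral fineK//; apply: integrable_fin_num => //.
    rewrite lee_fin.
    have := @Rintegral_le_density _ (K * d s) (fun t => `|f s * G s t|) setT 1
      measurableT _ ler01 n1.
    rewrite mul1r mulrAC => Hle; apply: le_trans (ler_norm _) _; apply: Hle.
      by rewrite mulr_ge0.
    by move=> t _; rewrite mul1r normr_id.
  have dK : mu.-integrable setT (EFin \o (fun s => K * cauchy_mass * d s)).
    by apply: integrable_scale => //; exact: integrable_cauchy_density.
  apply: (@le_lt_trans _ _
    (\int[mu]_(s in setT) ((K * cauchy_mass) * d s)%:E)%E).
    apply: ge0_le_integral => //.
    - by move=> s _; exact: integral_ge0.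
    - apply: (measurable_fun_fubini_tonelli_F (m2 := mu) (abse \o H)) => //.
        exact: measurableT_comp.
      by move=> z; exact: abse_ge0.
    - by have /integrableP[] := dK.
  have /integrable_lty := dK; exact.
have := Fubini iH.
move=> /(congr1 fine); rewrite /Rintegral => E.
transitivity (fine (\int[mu]_x \int[mu]_y H (x, y))).
  congr fine; apply: eq_integral => s _.
  by rewrite fineK//; apply: integrable_fin_num => //; exact: i1.
rewrite E; congr fine; apply: eq_integral => s _.
by rewrite fineK//; apply: integrable_fin_num => //; exact: i2.
Qed.

End Plane_Fubini.

(** * Injectivity of the cosine transform on the line *)

Section Fejer.
Context {R : realType}.
Local Notation mu := (@lebesgue_measure R).
Local Notation d := cauchy_density.
Implicit Types (u x t xi : R).

Lemma normr_mul_cos_le (r c : R) : `|r * cos c| <= `|r|.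
Proof. by rewrite normrM -[leRHS]mulr1 ler_wpM2l// cos_max. Qed.

Lemma is_derive_sin_scale u xi : is_derive xi 1 (fun xi => sin (xi * u))
  (u * cos (xi * u)).
Proof.
have := @is_derive1_comp R (@sin R) (fun xi => xi * u) xi (cos (xi * u)) u
  (is_derive_sin _).
rewrite mulrC; apply.
by apply: is_derive_eq; rewrite /GRing.scale /= mulr1 ?mulr0 ?addr0 ?add0r.
Qed.

Lemma is_derive_cos_scale u xi : is_derive xi 1 (fun xi => cos (xi * u))
  (- (u * sin (xi * u))).
Proof.
have := @is_derive1_comp R (@cos R) (fun xi => xi * u) xi (- sin (xi * u)) u
  (is_derive_cos _).
rewrite mulNr mulrC; apply.
by apply: is_derive_eq; rewrite /GRing.scale /= mulr1 ?mulr0 ?addr0 ?add0r.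
Qed.

(** The weight 1 - xi on the half-open interval ]0, 1], extended by 0.  The
    point 0 is left out because only nonzero frequencies are available. *)
Definition fejer_weight : R -> R := (fun xi => 1 - xi) \_ `]0, 1].

(** The cosine transform of the weight, a nonnegative integrable function. *)
Definition fejer_kernel u : R :=
  \int[mu]_(xi in setT) (fejer_weight xi * cos (xi * u)).

Lemma fejer_weight_le xi : `|fejer_weight xi| <= 2 * d xi.
Proof.
rewrite /fejer_weight patchE; case: ifPn => [|_]; last first.
  by rewrite normr0 mulr_ge0// ltW// cauchy_density_gt0.
rewrite inE /= in_itv /= => /andP[x0 x1].
rewrite /cauchy_density ler_pdivlMr ?add1sqr_gt0// ger0_norm; nra.
Qed.

Lemma measurable_fejer_weight : measurable_fun setT fejer_weight.
Proof.
apply/(measurable_restrictT _ (measurable_itv _)).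
apply: measurable_funTS; apply: continuous_measurable_fun => x.
by apply: cvgB; [exact: cvg_cst|exact: cvg_id].
Qed.

Lemma continuous_cos_scale u : continuous (fun xi : R => cos (xi * u)).
Proof.
by move=> xi; apply/differentiable_continuous/derivable1_diffP; have [] :=
  is_derive_cos_scale u xi.
Qed.

Lemma continuous_cos_scale_r xi : continuous (fun u : R => cos (xi * u)).
Proof.
rewrite (_ : (fun u => _) = (fun u => cos (u * xi)));
  first exact: continuous_cos_scale.
by apply/funext => u; rewrite mulrC.
Qed.

Lemma integrable_fejer_integrand u :
  mu.-integrable setT (EFin \o (fun xi => fejer_weight xi * cos (xi * u))).
Proof.
apply: (@integrable_le_density _ 2) => //.
  apply: measurable_funM; first exact: measurable_fejer_weight.
  by apply: continuous_measurable_fun; exact: continuous_cos_scale.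
by move=> xi _; exact: le_trans (normr_mul_cos_le _ _) (fejer_weight_le xi).
Qed.

Lemma continuous_fejer_kernel : continuous fejer_kernel.
Proof.
apply: (@continuous_Rintegral_param _ 2) => //.
- move=> u; apply: measurable_funM; first exact: measurable_fejer_weight.
  by apply: continuous_measurable_fun; exact: continuous_cos_scale.
- move=> xi u; apply: cvgM; first exact: cvg_cst.
  exact: continuous_cos_scale_r.
- move=> u xi; exact: le_trans (normr_mul_cos_le _ _) (fejer_weight_le xi).
Qed.

Lemma fejer_kernelE u : u != 0 -> fejer_kernel u = (1 - cos u) / u ^+ 2.
Proof.
move=> u0.
pose A xi := (1 - xi) * (sin (xi * u) / u) - cos (xi * u) / u ^+ 2.
have dA xi : is_derive xi 1 A ((1 - xi) * cos (xi * u)).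
  have H1 := is_derive_sin_scale u xi.
  have H2 := is_derive_cos_scale u xi.
  apply: is_derive_eq; rewrite /GRing.scale /=; field.
  by [].
have cA xi : {for xi, continuous A}.
  by apply/differentiable_continuous/derivable1_diffP; have [] := dA xi.
have cf : continuous (fun xi : R => (1 - xi) * cos (xi * u)).
  move=> xi; apply: cvgM; last exact: continuous_cos_scale.
  by apply: cvgB; [exact: cvg_cst|exact: cvg_id].
have -> : fejer_kernel u = \int[mu]_(xi in `]0, 1]) ((1 - xi) * cos (xi * u)).
  rewrite [RHS]Rintegral_mkcond; apply: eq_Rintegral => xi _.
  by rewrite /fejer_weight !patchE; case: ifPn => // _; rewrite mul0r.
rewrite Rintegral_itv_obnd_cbnd; last first.
  apply: (@integrable_le_density _ 2) => //.
    exact: continuous_measurable_fun.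
  move=> xi xi01; have := fejer_weight_le xi;
    rewrite /fejer_weight patchE mem_set//.
  apply: le_trans; rewrite normrM -[leRHS]mulr1 ler_wpM2l//.
  exact: cos_max.
rewrite /Rintegral (@continuous_FTC2 _ _ A)//.
- rewrite /= /A !mul1r !mul0r sin0 cos0; field.
  by [].
- by apply: continuous_subspaceT.
- split; first by move=> x _; have [] := dA x.
  + by apply: cvg_at_right_filter; exact: cA.
  + by apply: cvg_at_left_filter; exact: cA.
- by move=> x _; rewrite derive1E; have [] := dA x.
Qed.

Lemma fejer_kernel_ge0 u : 0 <= fejer_kernel u.
Proof.
have [->|u0] := eqVneq u 0; last first.
  rewrite fejer_kernelE// divr_ge0 ?sqr_ge0// subr_ge0; exact: cos_le1.
apply: Rintegral_ge0 => xi _; rewrite mulr0 cos0 mulr1 /fejer_weight patchE.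
case: ifPn => //; rewrite inE /= in_itv /= => /andP[_]; lra.
Qed.

Lemma fejer_kernel_le : exists K, forall u, `|fejer_kernel u| <= K * d u.
Proof.
have C0 := @cauchy_mass_ge0 R.
exists (4 + 4 * cauchy_mass) => u.
have d0 := cauchy_density_gt0 u.
have [u1|u1] := leP 1 (u ^+ 2).
  have u0 : u != 0 by apply/eqP => u0; move: u1; rewrite u0 expr0n /=; lra.
  rewrite ger0_norm ?fejer_kernel_ge0// fejer_kernelE//.
  apply: (@le_trans _ _ (4 * d u)); last by apply: ler_wpM2r; [exact: ltW|lra].
  rewrite ler_pdivrMr; last by lra.
  rewrite mulrAC ler_pdivlMr ?add1sqr_gt0//.
  have := cos_geN1 u; have := cos_le1 u; nra.
have : 1 * `|fejer_kernel u| <= 2 * cauchy_mass.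
  apply: Rintegral_le_density => //.
    exact: integrable_fejer_integrand.
  by move=> xi _; rewrite mul1r;
    exact: le_trans (normr_mul_cos_le _ _) (fejer_weight_le xi).
rewrite mul1r => H; apply: le_trans H _.
rewrite ler_pdivlMr ?add1sqr_gt0//; nra.
Qed.

(** The kernel is at least (1 - cos 1) / 4 on [1, 2], because cos decreases on
    [0, pi]. *)
Lemma fejer_kernel_integral_gt0 : 0 < \int[mu]_(u in setT) fejer_kernel u.
Proof.
have [K HK] := fejer_kernel_le.
have pi2 := @pi_ge2 R.
have c1 : cos 1 < 1 :> R.
  by rewrite -[ltRHS]cos0 ltr_cos ?in_itv /=; lra.
pose c : R := (1 - cos 1) / 4.
have c0 : 0 < c by rewrite divr_gt0// subr_gt0.
have cle u : u \in `[1, 2]%classic -> c <= fejer_kernel u.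
  rewrite inE /= in_itv /= => /andP[u1 u2].
  rewrite fejer_kernelE; last by rewrite gt_eqF//; lra.
  have cu : cos u <= cos 1.
    rewrite le_eqVlt; apply/orP.
    have [->|un] := eqVneq u 1; [by left|right].
    rewrite ltr_cos ?in_itv /=; [|lra|lra].
    by rewrite lt_neqAle eq_sym un.
  rewrite ler_pdivlMr; last by nra.
  have u4 : u ^+ 2 <= 4 by nra.
  apply: (@le_trans _ _ (c * 4)); first by rewrite ler_wpM2l// ltW.
  by rewrite /c; lra.
apply: (@lt_le_trans _ _ (\int[mu]_(u in setT) ((cst c) \_ `[1, 2]) u)).
  rewrite -Rintegral_mkcond Rintegral_cst; last exact: measurable_itv.
  have := lebesgue_measure_itv (`[1, 2] : interval R).
  by rewrite /= lte_fin ltr1n -EFinD => -> /=; rewrite mulr_gt0//; lra.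
apply: le_Rintegral => //.
- apply: (@integrable_le_density _ K) => //.
    by apply/(measurable_restrictT _ (measurable_itv _)); exact: measurable_cst.
  move=> u _; rewrite patchE; case: ifPn => [u12|_].
    rewrite /= (ger0_norm (ltW c0)); apply: le_trans (cle _ u12) _.
    by apply: le_trans (HK u); exact: ler_norm.
  by rewrite normr0; apply: le_trans (normr_ge0 _) (HK u).
- apply: (@integrable_le_density _ K) => //.
  by apply: continuous_measurable_fun; exact: continuous_fejer_kernel.
- move=> u _; rewrite patchE; case: ifPn => [u12|_]; first exact: cle.
  exact: fejer_kernel_ge0.
Qed.

(** A continuous function h = O (1 / (1 + t^2)) is determined by the integrals
    of h (t) cos (eta t + c) over t.  The frequency eta = 0 is not needed. *)
Lemma cos_transform_injective K (h : R -> R) : continuous h ->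
  (forall t, `|h t| <= K * d t) ->
  (forall eta c, eta != 0 ->
     \int[mu]_(t in setT) (h t * cos (eta * t + c)) = 0) ->
  forall t, h t = 0.
Proof.
move=> ch hK hyp t0.
have K0 : 0 <= K by exact: le_density_cst_ge0 hK.
have [Kk kK] := fejer_kernel_le.
have dge0 (s : R) : 0 <= d s by rewrite ltW// cauchy_density_gt0.
(* F e is a smoothing of h near t0 at the scale e; F 0 is h t0 times the
   integral of the kernel. *)
pose F e := \int[mu]_(u in setT) (h (e * u + t0) * fejer_kernel u).
have caff (e : R) : continuous (fun u => h (e * u + t0)).
  by move=> u; apply: continuous_comp; [exact: continuous_affine|exact: ch].
have Fpos e : 0 < e -> F e = 0.
  move=> e0.
  pose K' := K * (1 + 2 * (t0 ^+ 2 + 1) / e ^+ 2).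
  have hK' u : `|h (e * u + t0)| <= K' * d u.
    apply: le_trans (hK _) _; rewrite -mulrA ler_wpM2l//.
    by apply: cauchy_density_affine; rewrite gt_eqF.
  have K'0 : 0 <= K'.
    exact: le_density_cst_ge0 hK'.
  have ccos2 : continuous (fun z : R * R => cos (z.1 * z.2)).
    move=> z; apply: continuous_comp; last exact: continuous_cos.
    by apply: cvgM; [exact: cvg_fst|exact: cvg_snd].
  have ex := @Rintegral_exchange R (2 * K') fejer_weight
    (fun xi u => h (e * u + t0) * cos (xi * u)) measurable_fejer_weight _ _.
  (* inserting the definition of the kernel and exchanging the integrals
     leaves the hypothesis at the frequency xi / e *)
  have inner xi : \int[mu]_(u in setT)
    (fejer_weight xi * (h (e * u + t0) * cos (xi * u))) = 0.
    rewrite RintegralZl; last 2 first.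
    - exact: measurableT.
    - apply: (@integrable_le_density _ K') => //.
        apply: measurable_funM.
          by apply: continuous_measurable_fun; exact: caff.
        by apply: continuous_measurable_fun; exact: continuous_cos_scale_r.
      move=> u _; exact: le_trans (normr_mul_cos_le _ _) (hK' u).
    have [->|xi0] := eqVneq xi 0.
      rewrite /fejer_weight patchE ifF ?mul0r//.
      by apply/negbTE; rewrite notin_setE /= in_itv /= ltxx.
    have := hyp (xi / e) (- (xi / e) * t0) _.
    rewrite (@Rintegral_affine R K e t0)//.
    - have -> : \int[mu]_t
        (h (e * t + t0) * cos (xi / e * (e * t + t0) + - (xi / e) * t0)) =
        \int[mu]_(u in setT) (h (e * u + t0) * cos (xi * u)).
        apply: eq_Rintegral => u _; congr (_ * cos _); field.
        by rewrite gt_eqF.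
      move=> H; have : xi / e != 0 by rewrite mulf_neq0// invr_neq0// gt_eqF.
      by move=> /H /eqP; rewrite mulf_eq0 gt_eqF//= => /eqP ->; rewrite mulr0.
    - move=> t; apply: cvgM; first exact: ch.
      by apply: continuous_comp;
        [exact: continuous_affine|exact: continuous_cos].
    - move=> t; exact: le_trans (normr_mul_cos_le _ _) (hK t).
  transitivity (\int[mu]_(u in setT) \int[mu]_(xi in setT)
    (fejer_weight xi * (h (e * u + t0) * cos (xi * u)))).
    apply: eq_Rintegral => u _; rewrite /fejer_kernel -RintegralZl.
    - by apply: eq_Rintegral => xi _; ring.
    - exact: measurableT.
    - exact: integrable_fejer_integrand.
  rewrite -ex.
  - by under eq_Rintegral do rewrite inner; rewrite Rintegral_cst ?mul0r//;
      exact: measurableT.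
  - move=> z; apply: cvgM; last exact: ccos2.
    apply: (@continuous_comp _ _ _ (fun z : R * R => z.2) (fun u =>
      h (e * u + t0))).
      exact: cvg_snd.
    exact: caff.
  - move=> xi u; rewrite 2!normrM.
    have -> : 2 * K' * d xi * d u = (2 * d xi) * (K' * d u * 1) by ring.
    by rewrite !ler_pM ?mulr_ge0 ?fejer_weight_le ?hK' ?cos_max.
have cF : continuous F.
  apply: (@continuous_Rintegral_param _ (K * Kk)) => //.
  - move=> e; apply: measurable_funM.
      by apply: continuous_measurable_fun; exact: caff.
    by apply: continuous_measurable_fun; exact: continuous_fejer_kernel.
  - move=> u e; apply: cvgM; last exact: cvg_cst.
    apply: continuous_comp; last exact: ch.
    apply: cvgD; last exact: cvg_cst.
    by apply: cvgM; [exact: cvg_id|exact: cvg_cst].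
  - move=> e u; rewrite normrM -mulrA ler_pM//.
    apply: le_trans (hK _) _; rewrite -[leRHS]mulr1 ler_wpM2l//.
    exact: cauchy_density_le1.
have F0 : F 0 = 0.
  apply/eqP; apply/negPn/negP => F0n.
  have /cvgrPdist_lt/(_ `|F 0|) := cF 0.
  rewrite normr_gt0 => /(_ F0n) /nbhs_ballP[r /= r0 H].
  have /= := H (r / 2).
  rewrite /ball /= sub0r normrN gtr0_norm ?divr_gt0//.
  rewrite (Fpos (r / 2)) ?divr_gt0// subr0 ltxx.
  have r2 : r / 2 < r by lra.
  by move=> /(_ r2).
move: F0; rewrite /F.
under eq_Rintegral do rewrite mul0r add0r.
rewrite RintegralZl; last 2 first.
- exact: measurableT.
- apply: (@integrable_le_density _ Kk) => //.
  by apply: continuous_measurable_fun; exact: continuous_fejer_kernel.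
by move=> /eqP; rewrite mulf_eq0 (gt_eqF fejer_kernel_integral_gt0) orbF =>
  /eqP.
Qed.

End Fejer.

(** * Functions on the plane in coordinates *)

Section Plane_coordinates.
Context {R : realType}.
Local Notation d := cauchy_density.
Implicit Types (x y t K : R) (g : 'rV[R]_2 -> R).

(** The point with coordinates (x, y). *)
Definition point2 x y : 'rV[R]_2 := x *: delta_mx 0 0 + y *: delta_mx 0 1.
Local Notation pt := point2.

Lemma point2_0 x y : pt x y 0 0 = x.
Proof. by rewrite !mxE /= mulr1 mulr0 addr0. Qed.

Lemma point2_1 x y : pt x y 0 1 = y.
Proof. by rewrite !mxE /= mulr1 mulr0 add0r. Qed.

Lemma point2E (p : 'rV[R]_2) : p = pt (p 0 0) (p 0 1).
Proof.
apply/rowP => i; rewrite !mxE.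
by case: i => [[|[|//]] ip] /=; rewrite ?mulr1 ?mulr0 ?addr0 ?add0r;
  congr (p _ _); apply: val_inj.
Qed.

Lemma continuous_point2 : continuous (fun z : R * R => pt z.1 z.2).
Proof.
move=> z; apply: cvgD; apply: cvgZr_tmp; [exact: cvg_fst|exact: cvg_snd].
Qed.

Lemma continuous_in_coordinates g : continuous g ->
  continuous (fun z : R * R => g (pt z.1 z.2)).
Proof. by move=> cg z; apply: continuous_comp;
  [exact: continuous_point2|exact: cg]. Qed.

Lemma is_derive_partial0 g x y : derivable g (pt x y) (delta_mx 0 0) ->
  is_derive x 1 (fun x => g (pt x y)) (partial 0 g (pt x y)).
Proof.
move=> dg.
have E : (fun h : R =>
  h^-1 *: (((fun x => g (pt x y)) \o shift x) (h *: 1) - g (pt x y))) =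
    (fun h : R => h^-1 *: ((g \o shift (pt x y)) (h *: delta_mx 0 0) -
      g (pt x y))).
  apply/funext => h; congr (_ *: (g _ - _)).
  by rewrite /= /shift /pt scalerDl [_ *: 1]mulr1 addrA.
by apply: DeriveDef; rewrite /derivable /partial /derive E.
Qed.

Lemma is_derive_partial1 g x y : derivable g (pt x y) (delta_mx 0 1) ->
  is_derive y 1 (fun y => g (pt x y)) (partial 1 g (pt x y)).
Proof.
move=> dg.
have E : (fun h : R =>
  h^-1 *: (((fun y => g (pt x y)) \o shift y) (h *: 1) - g (pt x y))) =
    (fun h : R => h^-1 *: ((g \o shift (pt x y)) (h *: delta_mx 0 1) -
      g (pt x y))).
  apply/funext => h; congr (_ *: (g _ - _)).
  by rewrite /= /shift /pt scalerDl [_ *: 1]mulr1 addrCA.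
by apply: DeriveDef; rewrite /derivable /partial /derive E.
Qed.

(** Conversely, a derivative in the first coordinate is a partial derivative. *)
Lemma is_derive_to_partial0 g x y l : is_derive x 1 (fun x => g (pt x y)) l ->
  derivable g (pt x y) (delta_mx 0 0) /\ partial 0 g (pt x y) = l.
Proof.
have E : (fun h : R =>
  h^-1 *: (((fun x => g (pt x y)) \o shift x) (h *: 1) - g (pt x y))) =
    (fun h : R => h^-1 *: ((g \o shift (pt x y)) (h *: delta_mx 0 0) -
      g (pt x y))).
  apply/funext => h; congr (_ *: (g _ - _)).
  by rewrite /= /shift /pt scalerDl [_ *: 1]mulr1 addrA.
by case; rewrite /derivable /partial /derive E.
Qed.

Lemma is_derive_to_partial1 g x y l : is_derive y 1 (fun y => g (pt x y)) l ->
  derivable g (pt x y) (delta_mx 0 1) /\ partial 1 g (pt x y) = l.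
Proof.
have E : (fun h : R =>
  h^-1 *: (((fun y => g (pt x y)) \o shift y) (h *: 1) - g (pt x y))) =
    (fun h : R => h^-1 *: ((g \o shift (pt x y)) (h *: delta_mx 0 1) -
      g (pt x y))).
  apply/funext => h; congr (_ *: (g _ - _)).
  by rewrite /= /shift /pt scalerDl [_ *: 1]mulr1 addrCA.
by case; rewrite /derivable /partial /derive E.
Qed.

(** The mean value theorem, regardless of the order of x and y. *)
Lemma MVT_uniform (f df : R -> R) x y : (forall x, is_derive x 1 f (df x)) ->
  exists2 c, `|c - x| <= `|y - x| & f y - f x = df c * (y - x).
Proof.
move=> fd.
have cf a b : {within `[a, b], continuous f}.
  apply: continuous_subspaceT => z.
  by apply/differentiable_continuous/derivable1_diffP; have [] := fd z.
have [xy|/ltW yx] := leP x y.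
  have [c] := MVT_segment xy (fun z _ => fd z) (cf x y).
  rewrite in_itv /= => /andP[xc cy] E; exists c => //.
  by rewrite !ger0_norm; lra.
have [c] := MVT_segment yx (fun z _ => fd z) (cf y x).
rewrite in_itv /= => /andP[yc cx] E; exists c; last by lra.
by rewrite !ler0_norm; lra.
Qed.

(** The chain rule along a line for a function of two variables with continuous
    partial derivatives.  The increment is split into a horizontal and a
    vertical one, to which the mean value theorem applies. *)
Lemma is_derive_along_line (G G1 G2 : R -> R -> R) a b c e t :
  (forall x y, is_derive x 1 (G ^~ y) (G1 x y)) ->
  (forall x y, is_derive y 1 (G x) (G2 x y)) ->
  continuous (fun z : R * R => G1 z.1 z.2) ->
  continuous (fun z : R * R => G2 z.1 z.2) ->
  is_derive t 1 (fun t => G (a * t + b) (c * t + e))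
    (a * G1 (a * t + b) (c * t + e) + c * G2 (a * t + b) (c * t + e)).
Proof.
move=> d1 d2 c1 c2.
set x := a * t + b; set y := c * t + e.
set L := _ + _.
pose phi t := G (a * t + b) (c * t + e).
suff lim : (h^-1 *: ((phi \o shift t) (h *: 1) - phi t)) @[h --> 0^'] --> L.
  apply: DeriveDef; first by apply/cvg_ex; exists L.
  exact: (cvg_lim (@Rhausdorff R) lim).
apply/cvgrPdist_lt => eps eps0.
pose M := `|a| + `|c| + 1.
have M1 : 1 <= M by rewrite /M lerDr addr_ge0.
have M0 : 0 < M by lra.
have eM : 0 < eps / M by rewrite divr_gt0.
have /cvgrPdist_lt/(_ _ eM)/nbhs_ballP[r1 /= r10 H1] := c1 (x, y).
have /cvgrPdist_lt/(_ _ eM)/nbhs_ballP[r2 /= r20 H2] := c2 (x, y).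
pose r := Num.min r1 r2.
have r0 : 0 < r by rewrite lt_min r10.
apply/nbhs_ballP; exists (r / M); first by rewrite /= divr_gt0.
move=> h; rewrite /ball /= sub0r normrN => hr h0.
have hM : `|h| * M < r by rewrite -ltr_pdivlMr.
have ah : `|a * h| < r.
  apply: le_lt_trans hM; rewrite normrM mulrC ler_wpM2l// /M.
  by rewrite -addrA lerDl addr_ge0.
have ch : `|c * h| < r.
  apply: le_lt_trans hM; rewrite normrM mulrC ler_wpM2l// /M.
  by rewrite addrAC lerDr addr_ge0.
have E1 : a * (h *: 1 + t) + b = x + a * h by rewrite /x [_ *: 1]mulr1; ring.
have E2 : c * (h *: 1 + t) + e = y + c * h by rewrite /y [_ *: 1]mulr1; ring.
have -> : (phi \o shift t) (h *: 1) - phi t = G (x + a * h) (y + c * h) - G x y.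
  by rewrite /phi /= /shift E1 E2.
have [z1 z1b D1] := MVT_uniform x (x + a * h) (fun u => d1 u (y + c * h)).
have [z2 z2b D2] := MVT_uniform y (y + c * h) (fun u => d2 x u).
have -> : G (x + a * h) (y + c * h) - G x y =
    G1 z1 (y + c * h) * (a * h) + G2 x z2 * (c * h).
  have a1 : x + a * h - x = a * h by ring.
  have a2 : y + c * h - y = c * h by ring.
  move: D1 D2; rewrite a1 a2 /= => <- <-; ring.
have -> : h^-1 *: (G1 z1 (y + c * h) * (a * h) + G2 x z2 * (c * h)) =
   a * G1 z1 (y + c * h) + c * G2 x z2.
  by rewrite /GRing.scale /=; field.
have -> : L - (a * G1 z1 (y + c * h) + c * G2 x z2) =
   a * (G1 x y - G1 z1 (y + c * h)) + c * (G2 x y - G2 x z2) by rewrite /L;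
     ring.
have rr1 : r <= r1 by rewrite ge_min lexx.
have rr2 : r <= r2 by rewrite ge_min lexx orbT.
move: z1b z2b.
have -> : x + a * h - x = a * h by ring.
have -> : y + c * h - y = c * h by ring.
move=> z1b z2b.
have B1 : `|G1 x y - G1 z1 (y + c * h)| < eps / M.
  apply: (H1 (z1, y + c * h)); split; rewrite /ball /=.
    by rewrite distrC; apply: le_lt_trans z1b _; lra.
  rewrite opprD addNKr normrN; lra.
have B2 : `|G2 x y - G2 x z2| < eps / M.
  apply: (H2 (x, z2)); split; rewrite /ball /=.
    by rewrite subrr normr0.
  by rewrite distrC; apply: le_lt_trans z2b _; lra.
apply: le_lt_trans (ler_normD _ _) _; rewrite !normrM.
have : M * (eps / M) = eps by rewrite mulrC divfK// gt_eqF.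
move: B1 B2 eM; set q := eps / M; rewrite /M => B1 B2 q0 E.
have := normr_ge0 a; have := normr_ge0 c; nra.
Qed.

(** Derivation lists being read from the right, a partial derivative appends one
    direction at the end of the list. *)
Lemma smooth_partial g i : smooth g -> smooth (partial i g).
Proof.
by move=> sg s; have := sg (rcons s i); rewrite /partials foldr_rcons.
Qed.

Lemma smooth_continuous g : smooth g -> continuous g.
Proof. by move=> /(_ [::]) []. Qed.

Lemma smooth_derivable g i p : smooth g -> derivable g p (delta_mx 0 i).
Proof. by move=> /(_ [::]) []. Qed.

Lemma smooth_derive0 g x y : smooth g ->
  is_derive x 1 (fun x => g (pt x y)) (partial 0 g (pt x y)).
Proof. by move=> sg; apply: is_derive_partial0; exact: smooth_derivable. Qed.

Lemma smooth_derive1 g x y : smooth g ->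
  is_derive y 1 (fun y => g (pt x y)) (partial 1 g (pt x y)).
Proof. by move=> sg; apply: is_derive_partial1; exact: smooth_derivable. Qed.

Lemma smooth_continuous2 g : smooth g ->
  continuous (fun z : R * R => g (pt z.1 z.2)).
Proof. by move=> /smooth_continuous; exact: continuous_in_coordinates. Qed.

Lemma smooth_derive_line g a b c e t : smooth g ->
  is_derive t 1 (fun t => g (pt (a * t + b) (c * t + e)))
    (a * partial 0 g (pt (a * t + b) (c * t + e)) +
     c * partial 1 g (pt (a * t + b) (c * t + e))).
Proof.
move=> sg.
apply: (@is_derive_along_line (fun x y => g (pt x y)) (fun x y =>
  partial 0 g (pt x y))
  (fun x y => partial 1 g (pt x y))).
- by move=> x y; exact: smooth_derive0.
- by move=> x y; exact: smooth_derive1.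
- by apply: smooth_continuous2; exact: smooth_partial.
- by apply: smooth_continuous2; exact: smooth_partial.
Qed.

Lemma smooth_continuous_line g a b c e : smooth g ->
  continuous (fun t => g (pt (a * t + b) (c * t + e))).
Proof.
move=> sg t; apply/differentiable_continuous/derivable1_diffP.
by have [] := smooth_derive_line a b c e t sg.
Qed.

Lemma schwartz_partial g i : schwartz g -> schwartz (partial i g).
Proof.
move=> [sg dg]; split; first exact: smooth_partial.
move=> k l s; have [C HC] := dg k l (rcons s i); exists C => x.
by have := HC x; rewrite /partials foldr_rcons.
Qed.

(** The monomial bounds of the definition combine into bounds with powers of
    1 + x^2 + y^2, by expanding the power one factor at a time. *)
Lemma schwartz_decay g m : schwartz g -> exists2 K, 0 <= K &
  forall x y, (1 + x ^+ 2 + y ^+ 2) ^+ m * `|g (pt x y)| <= K.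
Proof.
move=> [_ dg].
suff /(_ 0%N 0%N)[C HC] : forall k l, exists C, forall x y,
    `|x ^+ k * y ^+ l * (1 + x ^+ 2 + y ^+ 2) ^+ m * g (pt x y)| <= C.
  exists C; first exact: le_trans (normr_ge0 _) (HC 0 0).
  move=> x y; have := HC x y; rewrite !expr0 !mul1r normrM ger0_norm//.
  by apply: exprn_ge0; have := sqr_ge0 x; have := sqr_ge0 y; lra.
elim: m => [|m IH] k l.
  have [C HC] := dg k l [::]; exists C => x y.
  by have := HC (pt x y); rewrite point2_0 point2_1 /= expr0 mulr1.
have [C1 H1] := IH k l; have [C2 H2] := IH (k + 2)%N l; have [C3 H3] :=
  IH k (l + 2)%N.
exists (C1 + C2 + C3) => x y.
have -> : x ^+ k * y ^+ l * (1 + x ^+ 2 + y ^+ 2) ^+ m.+1 * g (pt x y) =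
  x ^+ k * y ^+ l * (1 + x ^+ 2 + y ^+ 2) ^+ m * g (pt x y) +
  x ^+ (k + 2) * y ^+ l * (1 + x ^+ 2 + y ^+ 2) ^+ m * g (pt x y) +
  x ^+ k * y ^+ (l + 2) * (1 + x ^+ 2 + y ^+ 2) ^+ m * g (pt x y).
  by rewrite !exprD exprS; ring.
apply: le_trans (ler_normD _ _) _; apply: lerD => //.
by apply: le_trans (ler_normD _ _) _; apply: lerD.
Qed.

End Plane_coordinates.

(** * Injectivity of the X-ray transform *)

Section Xray.
Context {R : realType}.
Local Notation mu := (@lebesgue_measure R).
Local Notation d := cauchy_density.
Local Notation pt := point2.
Implicit Types (x y t s a K : R) (g : 'rV[R]_2 -> R).

(** Decay in (x, t) with x = s - a t implies decay in (s, t), at the price of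
    one factor d t. *)
Lemma cauchy_density_shear a s t : d (s - a * t) * d t <=
  2 * (1 + a ^+ 2) * d s.
Proof.
rewrite /cauchy_density -invfM ler_pdivlMr ?add1sqr_gt0//.
rewrite mulrC ler_pdivrMr; last by rewrite mulr_gt0 ?add1sqr_gt0.
have [u ->] : exists u, s = u + a * t by exists (s - a * t); ring.
have -> : u + a * t - a * t = u by ring.
have := sqr_ge0 (u - a * t); have := sqr_ge0 u; have := sqr_ge0 t; have :=
  sqr_ge0 a.
have := sqr_ge0 (a * u); have := sqr_ge0 (u * t); have := sqr_ge0 (a * t);
  have := sqr_ge0 (a * u * t).
rewrite !exprMn; nra.
Qed.

(** Injectivity of the X-ray transform on continuous functions of rapid decay,
    from the non-horizontal lines only. *)
Lemma xray_injective K (w : R -> R -> R) :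
  continuous (fun z : R * R => w z.1 z.2) ->
  (forall x y, `|w x y| <= K * d x * (d y * d y)) ->
  (forall s a, \int[mu]_(t in setT) w (s - a * t) t = 0) ->
  forall x y, w x y = 0.
Proof.
move=> cw wK hyp.
have d0 := @cauchy_density_ge0 R.
have K0 : 0 <= K.
  have := le_trans (normr_ge0 _) (wK 0 0).
  rewrite !pmulr_lge0 ?mulr_gt0//; exact: cauchy_density_gt0.
have wK1 x y : `|w x y| <= K * d x * d y.
  apply: le_trans (wK x y) _; rewrite ler_wpM2l ?mulr_ge0//.
  by rewrite -[leRHS]mulr1 ler_wpM2l// cauchy_density_le1.
have ccos a c : continuous (fun t : R => cos (a * t + c)).
  by move=> t; apply: continuous_comp;
    [exact: continuous_affine|exact: continuous_cos].
have cwl y : continuous (w ^~ y) by apply: (@continuous_curry_r R w).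
have cwr x : continuous (w x) by apply: (@continuous_curry_l R w).
(* Q xi eta c t is the inner integral of a double cosine transform *)
pose Q xi eta c t := \int[mu]_(x in setT) (w x t * cos (xi * x + eta * t + c)).
have cwcos xi c t : continuous (fun x => w x t * cos (xi * x + c)).
  by move=> x; apply: cvgM; [exact: cwl|exact: ccos].
have iQ xi c t : mu.-integrable setT
  (EFin \o (fun x => w x t * cos (xi * x + c))).
  apply: (@integrable_le_density _ (K * d t)) => //.
    by apply: continuous_measurable_fun; exact: cwcos.
  by move=> x _; apply: le_trans (normr_mul_cos_le _ _) _; rewrite mulrAC wK1.
have QE xi eta c t : Q xi eta c t =
  \int[mu]_(x in setT) (w x t * cos (xi * x + (eta * t + c))).
  by apply: eq_Rintegral => x _; rewrite addrA.
have QK xi eta c t : `|Q xi eta c t| <= K * cauchy_mass * d t.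
  rewrite QE mulrAC -[leLHS]mul1r.
  apply: Rintegral_le_density => //; first by rewrite mulr_ge0.
  by move=> x _; rewrite mul1r; apply: le_trans (normr_mul_cos_le _ _) _;
    rewrite mulrAC wK1.
have cQ xi eta c : continuous (Q xi eta c).
  apply: (@continuous_Rintegral_param _ K) => //.
  - move=> t; apply: measurable_funM; first exact: continuous_measurable_fun.
    apply: continuous_measurable_fun.
    rewrite (_ : (fun x => _) = (fun x => cos (xi * x + (eta * t + c))));
      first exact: ccos.
    by apply/funext => x; rewrite addrA.
  - move=> x t; apply: cvgM; first exact: cwr.
    have E : (fun u => cos (eta * u + (xi * x + c))) =
      (fun u => cos (xi * x + eta * u + c)).
      by apply/funext => u; congr cos; ring.
    by have := ccos eta (xi * x + c) t; rewrite E.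
  - move=> t x; apply: le_trans (normr_mul_cos_le _ _) _;
      apply: le_trans (wK1 _ _) _.
    by rewrite -[leRHS]mulr1 ler_wpM2l ?mulr_ge0// cauchy_density_le1.
have Q0 xi eta c : xi != 0 -> \int[mu]_(t in setT) Q xi eta c t = 0.
  (* xi x + eta t is constant, equal to xi s, on the line of parameters s and
     a = eta / xi *)
  move=> xi0; pose a := eta / xi.
  have shear s t : `|w (s - a * t) t| <= K * (2 * (1 + a ^+ 2)) * d s * d t.
    apply: le_trans (wK _ _) _.
    rewrite mulrA; apply: ler_wpM2r => //.
    by rewrite -mulrA -[leRHS]mulrA ler_wpM2l// cauchy_density_shear.
  have cG : continuous (fun z : R * R => w (z.1 - a * z.2) z.2).
    move=> z; apply: (@continuous2_cvg _ R R R _ _ (fun z : R * R =>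
      z.1 - a * z.2) snd w
      (z.1 - a * z.2) z.2).
    - exact: (cw (z.1 - a * z.2, z.2)).
    - apply: cvgB; first exact: cvg_fst.
      by apply: cvgM; [exact: cvg_cst|exact: cvg_snd].
    - exact: cvg_snd.
  have ex := @Rintegral_exchange R (K * (2 * (1 + a ^+ 2))) (fun s =>
    cos (xi * s + c))
    (fun s t => w (s - a * t) t) _ cG _.
  transitivity (\int[mu]_(t in setT) \int[mu]_(s in setT)
    (cos (xi * s + c) * w (s - a * t) t)).
    apply: eq_Rintegral => t _.
    rewrite [RHS](@Rintegral_affine R (K * (2 * (1 + a ^+ 2)) * d t) 1
      (a * t))//.
    - rewrite mul1r; apply: eq_Rintegral => x _.
      rewrite mul1r mulrC; congr (cos _ * w _ t); last by ring.
      by rewrite /a; field.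
    - move=> s; apply: cvgM; first exact: ccos.
      exact: (@continuous_curry_r R (fun s t => w (s - a * t) t)).
    - move=> s; rewrite mulrC; apply: le_trans (normr_mul_cos_le _ _) _;
        apply: le_trans (shear s t) _.
      by rewrite mulrAC.
  rewrite -ex; first last.
  - move=> s t; rewrite mulrC; apply: le_trans (normr_mul_cos_le _ _) _;
      exact: shear.
  - by apply: continuous_measurable_fun; exact: ccos.
  transitivity (\int[mu]_(s in setT) (0 : R));
    last by rewrite Rintegral_cst ?mul0r//; exact: measurableT.
  apply: eq_Rintegral => s _; rewrite RintegralZl ?hyp ?mulr0//.
  apply: (@integrable_le_density _ (K * (2 * (1 + a ^+ 2)) * d s)) => //.
  by apply: continuous_measurable_fun;
    exact: (@continuous_curry_l R (fun s t => w (s - a * t) t)).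
have intQ xi eta c : mu.-integrable setT (EFin \o (Q xi eta c)).
  apply: (@integrable_le_density _ (K * cauchy_mass)) => //.
  by apply: continuous_measurable_fun; exact: cQ.
(* cos (A) cos (B) being half the sum of cos (A + B) and cos (A - B), the
   double integrals determine the inner one *)
have P0 xi c t : xi != 0 -> \int[mu]_(x in setT) (w x t * cos (xi * x + c)) = 0.
  move=> xi0.
  rewrite (_ : \int[mu]_(x in setT) _ = Q xi 0 c t); last first.
    by apply: eq_Rintegral => x _; rewrite mul0r addr0.
  apply: (@cos_transform_injective R (K * cauchy_mass)) => // eta c2 _.
  transitivity (\int[mu]_(u in setT)
    (2^-1 * (Q xi eta (c + c2) u + Q xi (- eta) (c - c2) u))).
    apply: eq_Rintegral => u _.
    rewrite !QE -RintegralD//.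
    rewrite mulrC -RintegralZl//.
    rewrite -RintegralZl//; last exact: integrable_add.
    apply: eq_Rintegral => x _.
    have -> : xi * x + (eta * u + (c + c2)) = (xi * x + (0 * u + c)) +
      (eta * u + c2) by ring.
    have -> : xi * x + (- eta * u + (c - c2)) = (xi * x + (0 * u + c)) -
      (eta * u + c2) by ring.
    set A := xi * x + (0 * u + c); set B := eta * u + c2.
    by rewrite (cosD A B) (cosB A B); field.
  rewrite RintegralZl//; last by apply: integrable_add.
  by rewrite RintegralD// !Q0// addr0 mulr0.
move=> x y.
apply: (@cos_transform_injective R (K * d y) (w ^~ y)) => //.
- by move=> t; rewrite mulrAC wK1.
- by move=> eta c eta0; exact: P0.
Qed.

End Xray.

(** * Schwartz functions and closed forms *)

Section Schwartz_forms.
Context {R : realType}.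
Local Notation mu := (@lebesgue_measure R).
Local Notation d := cauchy_density.
Local Notation pt := point2.
Implicit Types (x y t s a K : R) (g h : 'rV[R]_2 -> R).

Lemma ord2_eq (i : 'I_2) : i = 0 \/ i = 1.
Proof. by case: i => [[|[|//]] ip]; [left|right]; apply: val_inj. Qed.

(** A Schwartz function, even multiplied by a monomial, is dominated in both
    variables by the square of the density. *)
Lemma schwartz_bound g k l : schwartz g -> exists2 K, 0 <= K &
  forall x y, `|x ^+ k * y ^+ l * g (pt x y)| <= K * (d x * d x) * (d y * d y).
Proof.
move=> sg; have [K K0 HK] := schwartz_decay (k + l + 4) sg; exists K => // x y.
have x0 := add1sqr_gt0 x; have y0 := add1sqr_gt0 y.
have sx := sqr_ge0 x; have sy := sqr_ge0 y.
have -> : K * (d x * d x) * (d y * d y) =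
    K / ((1 + x ^+ 2) * (1 + x ^+ 2) * ((1 + y ^+ 2) * (1 + y ^+ 2))).
  by rewrite /cauchy_density !invfM; ring.
rewrite ler_pdivlMr; last by rewrite !mulr_gt0.
apply: le_trans (HK x y).
rewrite !normrM !normrX [leRHS]mulrC.
have -> : `|x| ^+ k * `|y| ^+ l * `|g (pt x y)| *
  ((1 + x ^+ 2) * (1 + x ^+ 2) * ((1 + y ^+ 2) * (1 + y ^+ 2))) =
  `|g (pt x y)| *
    (`|x| ^+ k * `|y| ^+ l * ((1 + x ^+ 2) ^+ 2 * (1 + y ^+ 2) ^+ 2)) by ring.
apply: ler_wpM2l; first exact: normr_ge0.
set N := 1 + x ^+ 2 + y ^+ 2.
have N0 : 0 <= N by rewrite /N; lra.
have xN : 1 + x ^+ 2 <= N by rewrite /N; lra.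
have yN : 1 + y ^+ 2 <= N by rewrite /N; lra.
have pw z n : 0 < 1 + z ^+ 2 -> 1 + z ^+ 2 <= N -> (1 + z ^+ 2) ^+ n <= N ^+ n.
  by move=> z0 zN; apply: lerXn2r => //; rewrite nnegrE ltW.
rewrite (_ : (k + l + 4 = k + l + (2 + 2))%N)// !exprD.
have X0 := ltW x0; have Y0 := ltW y0.
apply: ler_pM.
- by rewrite mulr_ge0 ?exprn_ge0.
- by rewrite mulr_ge0 ?exprn_ge0.
- by apply: ler_pM; rewrite ?exprn_ge0//;
    apply: le_trans (expr_le_add1sqr _ _) _; exact: pw.
- by apply: ler_pM; rewrite ?exprn_ge0//; exact: pw.
Qed.

Lemma schwartz_bound_x g k l : schwartz g -> exists2 K, 0 <= K &
  forall x y, `|x ^+ k * y ^+ l * g (pt x y)| <= K * d x * d x.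
Proof.
move=> sg; have [K K0 HK] := schwartz_bound k l sg; exists K => // x y.
apply: le_trans (HK x y) _; rewrite -[K * d x * d x]mulrA -[leRHS]mulr1.
have d0 := @cauchy_density_ge0 R; have d1 := @cauchy_density_le1 R.
by apply: ler_wpM2l; rewrite ?mulr_ge0// mulr_ile1.
Qed.

Lemma schwartz_vanishes g : schwartz g -> vanishes_at_infinity g.
Proof.
move=> sg e e0; have [K K0 HK] := schwartz_decay 1 sg.
exists (K / e + 1) => p Mp.
have Ke : 0 <= K / e by rewrite divr_ge0// ltW.
have := HK (p 0 0) (p 0 1); rewrite -point2E expr1.
have E : euclid_norm p ^+ 2 = p 0 0 ^+ 2 + p 0 1 ^+ 2.
  rewrite sqr_sqrtr /dot big_ord_recr big_ord1 /=.
    by rewrite !expr2; congr (p _ _ * p _ _ + p _ _ * p _ _); apply: val_inj.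
  by rewrite addr_ge0// -expr2 sqr_ge0.
rewrite -addrA -E => H.
move: Mp; set r := euclid_norm p in H * => Mp.
have : K / e * e = K by rewrite divfK// gt_eqF.
move: Ke Mp; set q := K / e => q0 Mp qe.
rewrite -(@ltr_pM2l _ (1 + r ^+ 2)) ?add1sqr_gt0//.
apply: le_lt_trans H _; rewrite -qe ltr_pM2r//; nra.
Qed.

Lemma schwartz_bounded g : schwartz g -> exists2 C, 0 <= C & forall x y,
  `|g (pt x y)| <= C.
Proof.
move=> sg; have [K K0 HK] := schwartz_decay 0 sg; exists K => // x y.
by have := HK x y; rewrite expr0 mul1r.
Qed.

(** Bounded partial derivatives make a function Lipschitz, hence continuous. *)
Lemma lipschitz_continuous (u : 'rV[R]_2 -> R) (g h : R -> R -> R) C :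
  (forall x y, is_derive x 1 (fun x => u (pt x y)) (g x y)) ->
  (forall x y, is_derive y 1 (fun y => u (pt x y)) (h x y)) ->
  (forall x y, `|g x y| <= C) -> (forall x y, `|h x y| <= C) -> 0 <= C ->
    continuous u.
Proof.
move=> d1 d2 gC hC C0 p; apply/(@cvgrPdist_lt _ _ _ _ (nbhs_filter p)) => e e0.
pose D := 2 * C + 1.
have D0 : 0 < D by rewrite /D; lra.
apply/nbhs_ballP; exists (e / D) => /=; first by rewrite divr_gt0.
move=> q pq.
have p0 : `|p 0 0 - q 0 0| < e / D by exact: pq.2.
have p1 : `|p 0 1 - q 0 1| < e / D by exact: pq.2.
rewrite (point2E p) (point2E q).
move: p0 p1; move: (p 0 0) (p 0 1) (q 0 0) (q 0 1) => {pq} x y x' y' xx yy.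
have [z1 _ E1] := MVT_uniform x' x (fun z => d1 z y).
have [z2 _ E2] := MVT_uniform y' y (fun z => d2 x' z).
have -> : u (pt x y) - u (pt x' y') = g z1 y * (x - x') + h x' z2 * (y - y').
  by rewrite -E1 -E2; ring.
apply: le_lt_trans (ler_normD _ _) _; rewrite !normrM.
have : D * (e / D) = e by rewrite mulrC divfK// gt_eqF.
move: xx yy; set r := e / D => xx yy; rewrite /D => <-.
have H1 : `|g z1 y| * `|x - x'| <= C * r by apply: ler_pM => //; exact: ltW.
have H2 : `|h x' z2| * `|y - y'| <= C * r by apply: ler_pM => //; exact: ltW.
have : 0 < r by apply: le_lt_trans xx.
move=> r0; have -> : (2 * C + 1) * r = C * r + C * r + r by ring.
lra.
Qed.

(** A closed 1-form g dx + h dy with Schwartz coefficients is the differential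
    of a Schwartz function. *)
Lemma closed_schwartz_form_exact g h : schwartz g -> schwartz h ->
  (forall p, partial 1 g p = partial 0 h p) ->
  exists U, [/\ schwartz U, partial 0 U = g & partial 1 U = h].
Proof.
move=> sg sh gh.
have d0 := @cauchy_density_ge0 R; have d1 := @cauchy_density_le1 R.
have C0 := @cauchy_mass_ge0 R.
have cont g' y : schwartz g' -> continuous (fun x => g' (pt x y)).
  by move=> [sg' _];
    exact: (@continuous_curry_r R (fun x y => g' (pt x y)) y
    (smooth_continuous2 sg')).
have [K K0 gK] := schwartz_bound_x 0 0 sg.
have [K1 K10 gK1] := schwartz_bound_x 0 0 (schwartz_partial 1 sg).
have {}gK x y : `|g (pt x y)| <= K * d x by apply: le_density_sqr => //; have :=
  gK x y; rewrite !expr0 !mul1r.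
have {}gK1 x y : `|partial 1 g (pt x y)| <= K1 * d x * d x by have := gK1 x y;
  rewrite !expr0 !mul1r.
have mg y : measurable_fun setT (fun x => g (pt x y)).
  by apply: continuous_measurable_fun; exact: cont.
pose u x y := \int[mu]_(s in `]-oo, x]) g (pt s y).
pose U (p : 'rV[R]_2) := u (p 0 0) (p 0 1).
have UE x y : U (pt x y) = u x y by rewrite /U point2_0 point2_1.
have dy (B : set R) y : measurable B ->
    is_derive y 1 (fun y => \int[mu]_(s in B) g (pt s y))
      (\int[mu]_(s in B) partial 1 g (pt s y)).
  move=> mB.
  apply: (@is_derive_Rintegral_param _ (K + K1) (fun y s => g (pt s y))
    (fun y s => partial 1 g (pt s y))) => //.
  - by move=> z t; apply: smooth_derive1; exact: sg.1.
  - by move=> z t; apply: le_trans (gK _ _) _; rewrite ler_wpM2r// lerDl.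
  - move=> z t; apply: (@le_trans _ _ (K1 * d t));
      first by apply: le_density_sqr.
    by rewrite ler_wpM2r// lerDr.
have ht y : tends0_infty (fun x => h (pt x y)).
  move=> e e0; have [M HM] := schwartz_vanishes sh e0.
  exists M => t Mt; apply: HM; apply: le_trans Mt _.
  rewrite -sqrtr_sqr ler_wsqrtr// /dot big_ord_recr big_ord1 /=.
  rewrite (_ : widen_ord _ _ = 0); last exact: val_inj.
  by rewrite point2_0 expr2 lerDl -expr2 sqr_ge0.
have ux x y : is_derive x 1 (u ^~ y) (g (pt x y)).
  by apply: (@is_derive_integralNy _ K (fun s => g (pt s y))) => //;
    exact: cont.
have pc y : continuous (fun x => partial 1 g (pt x y)) by apply: cont;
  exact: schwartz_partial.
have hd x y : is_derive x 1 (fun x => h (pt x y)) (partial 1 g (pt x y)).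
  by rewrite gh; apply: smooth_derive0; exact: sh.1.
have uy x y : is_derive y 1 (u x) (h (pt x y)).
  have := dy `]-oo, x]%classic y (measurable_itv _).
  by rewrite (@primitiveNy _ K1 (fun x => h (pt x y)) (fun x =>
    partial 1 g (pt x y))).
(* The integral of g over a horizontal line has zero derivative in y, because
   d_2 g = d_1 h, and tends to 0 with 1 / y, hence is zero. *)
have total y : \int[mu]_(s in setT) g (pt s y) = 0.
  pose m (y : R) : R := \int[mu]_(s in setT) g (pt s y).
  have [K2 K20 gK2] := schwartz_bound_x 0 1 sg.
  have mb z : `|z| * `|m z| <= K2 * cauchy_mass.
    apply: Rintegral_le_density => //.
      by apply: (@integrable_le_density _ K).
    move=> t _; have := gK2 t z; rewrite expr0 mul1r expr1 => /le_density_sqr.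
    by rewrite normrM.
  have mc z : m z = m y.
    suff md (z' : R) : is_derive z' (1 : R) m (0 : R)
      by exact: (@is_derive_0_is_cst R m z y md).
    have := dy setT z' measurableT.
    by rewrite (@Rintegral_derive _ K1 (fun x => h (pt x z')) (fun x =>
      partial 1 g (pt x z'))).
  rewrite -/(m y); apply/eqP/negPn/negP => my0.
  have my : 0 < `|m y| by rewrite normr_gt0.
  pose z := K2 * cauchy_mass / `|m y| + 1.
  have z0 : 0 <= z by rewrite addr_ge0// divr_ge0// mulr_ge0.
  have zm : z * `|m y| = K2 * cauchy_mass + `|m y|.
    by rewrite /z mulrDl divfK ?gt_eqF// mul1r.
  by have := mb z; rewrite mc (ger0_norm z0) zm; lra.
have Ux x y : is_derive x 1 (fun x => U (pt x y)) (g (pt x y)).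
  by rewrite (_ : (fun x => _) = u ^~ y)//; apply/funext => z; rewrite UE.
have Uy x y : is_derive y 1 (fun y => U (pt x y)) (h (pt x y)).
  by rewrite (_ : (fun y => _) = u x)//; apply/funext => z; rewrite UE.
have Ud x y := is_derive_to_partial0 (Ux x y).
have Ud1 x y := is_derive_to_partial1 (Uy x y).
have U0 : partial 0 U = g by apply/funext => p; rewrite (point2E p);
  exact: (Ud _ _).2.
have U1 : partial 1 U = h by apply/funext => p; rewrite (point2E p);
  exact: (Ud1 _ _).2.
exists U; split => //.
have cU : continuous U.
  have [C1 C10 gC] := schwartz_bounded sg; have [C2 C20 hC] :=
    schwartz_bounded sh.
  apply: (@lipschitz_continuous U (fun x y => g (pt x y)) (fun x y =>
    h (pt x y)) (C1 + C2) Ux Uy).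
  - by move=> x y; apply: le_trans (gC _ _) _; rewrite lerDl.
  - by move=> x y; apply: le_trans (hC _ _) _; rewrite lerDr.
  - by rewrite addr_ge0.
(* A derivative of U of positive order is a derivative of g or of h. *)
have pU (s : seq 'I_2) i : partials (rcons s i) U =
  partials s (if i == 0 then g else h).
  have E : partial i U = (if i == 0 then g else h) by case: (ord2_eq i) => ->.
  by rewrite /partials foldr_rcons E.
split.
  move=> s; case: (lastP s) => [|s' i]; last first.
    by rewrite pU; case: ifP => _; [exact: sg.1|exact: sh.1].
  split=> // i p /=; rewrite (point2E p).
  by case: (ord2_eq i) => ->; [exact: (Ud _ _).1|exact: (Ud1 _ _).1].
move=> k l s; case: (lastP s) => [|s' i]; last first.
  by rewrite pU; case: ifP => _; [exact: sg.2|exact: sh.2].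
have [K2 K20 gK2] := schwartz_bound_x k l sg.
exists (K2 * cauchy_mass) => p; rewrite [partials _ _]/=.
rewrite {3}(point2E p) UE; move: (p 0 0) (p 0 1) => x y.
have gi (B : set R) : measurable B ->
  mu.-integrable B (EFin \o (fun s => g (pt s y))).
  by move=> mB; apply: (@integrable_le_density _ K).
(* Integrating over the half-line bounded by x that does not contain 0, the
   factor |x|^k is at most |s|^k and is absorbed by g. *)
have bnd (B : set R) : measurable B -> (forall s, B s -> `|x| <= `|s|) ->
    `|x ^+ k * y ^+ l| * `|\int[mu]_(s in B) g (pt s y)| <= K2 * cauchy_mass.
  move=> mB HB; apply: Rintegral_le_density => //; first exact: gi.
  move=> t /HB xt; rewrite -normrM; apply: le_density_sqr.
  apply: le_trans (gK2 t y).
  rewrite !normrM !normrX; apply: ler_wpM2r => //; apply: ler_wpM2r;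
    first by rewrite exprn_ge0.
  by apply: lerXn2r => //; rewrite nnegrE.
rewrite normrM; have [x0|x0] := leP x 0.
  apply: bnd => // t /=; rewrite in_itv /= => tx.
  by rewrite !ler0_norm; lra.
have := @Rintegral_compl R K (fun s => g (pt s y)) x (cont _ _ sg) (fun s =>
  gK s y).
rewrite total => /eqP; rewrite eq_sym addrC addr_eq0 => /eqP E.
rewrite -[X in _ * X]normrN [u x y]/u -E; apply: bnd => // t /=;
  rewrite in_itv /= andbT => tx.
by rewrite !ger0_norm; lra.
Qed.

End Schwartz_forms.

(** * Integral moments over non-horizontal lines *)

Section Moments.
Context {R : realType}.
Local Notation mu := (@lebesgue_measure R).
Local Notation d := cauchy_density.
Local Notation pt := point2.
Implicit Types (x y t s a K : R) (g h : 'rV[R]_2 -> R).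

(** The moment of order k of g along the line t |-> (s - a t, t). *)
Definition slope_moment k g s a : R :=
  \int[mu]_(t in setT) (t ^+ k * g (pt (s - a * t) t)).
Local Notation T := slope_moment.

Lemma schwartz_bound_y g k : schwartz g -> exists2 K, 0 <= K &
  forall x y, `|y ^+ k * g (pt x y)| <= K * d y * d y.
Proof.
move=> sg; have [K K0 HK] := schwartz_bound 0 k sg; exists K => // x y.
have := HK x y; rewrite expr0 mul1r => H; apply: le_trans H _.
have d0 := @cauchy_density_ge0 R; have d1 := @cauchy_density_le1 R.
rewrite mulrA; apply: ler_wpM2r => //; apply: ler_wpM2r => //.
by rewrite -[leRHS]mulr1 ler_wpM2l// mulr_ile1.
Qed.

Lemma schwartz_bound_y1 g k : schwartz g -> exists2 K, 0 <= K &
  forall x y, `|y ^+ k * g (pt x y)| <= K * d y.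
Proof.
move=> sg; have [K K0 HK] := schwartz_bound_y k sg; exists K => // x y.
exact: le_density_sqr.
Qed.

Lemma slopeE s a t : pt (s - a * t) t = pt ((- a) * t + s) (1 * t + 0).
Proof. by rewrite mulNr mul1r addr0 addrC. Qed.

Lemma continuous_slope g s a : smooth g ->
  continuous (fun t => g (pt (s - a * t) t)).
Proof.
move=> sg; rewrite (_ : (fun t => _) =
  fun t => g (pt ((- a) * t + s) (1 * t + 0))).
  exact: smooth_continuous_line.
by apply/funext => t; rewrite slopeE.
Qed.

Lemma continuous_monomial_slope g k s a : smooth g ->
  continuous (fun t => t ^+ k * g (pt (s - a * t) t)).
Proof.
by move=> sg t; apply: cvgM; [exact: exprn_continuous|exact: continuous_slope].
Qed.

Lemma integrable_slope g k s a : schwartz g ->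
  mu.-integrable setT (EFin \o (fun t => t ^+ k * g (pt (s - a * t) t))).
Proof.
move=> sg; have [K K0 HK] := schwartz_bound_y1 k sg.
apply: (@integrable_le_density _ K) => //.
by apply: continuous_measurable_fun; apply: continuous_monomial_slope;
  exact: sg.1.
Qed.

Lemma slope_moment_derive_s k g s a : schwartz g ->
  is_derive s 1 (fun s => T k g s a) (T k (partial 0 g) s a).
Proof.
move=> sg; have sg1 := schwartz_partial 0 sg.
have [K K0 HK] := schwartz_bound_y1 k sg; have [K1 K10 HK1] :=
  schwartz_bound_y1 k sg1.
have dge0 := @cauchy_density_ge0 R.
have D x t : is_derive x 1 (fun x => t ^+ k * g (pt (x - a * t) t))
    (t ^+ k * partial 0 g (pt (x - a * t) t)).
  have := smooth_derive_line 1 (- a * t) 0 t x sg.1.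
  rewrite (_ : (fun x => g _) = (fun x => g (pt (x - a * t) t))); last first.
    by apply/funext => z; rewrite mul1r mul0r add0r mulNr.
  rewrite !mul1r !mul0r add0r addr0 mulNr => H.
  by apply: is_derive_eq.
apply: (@is_derive_Rintegral_param _ (K + K1) (fun x t =>
  t ^+ k * g (pt (x - a * t) t))
  (fun x t => t ^+ k * partial 0 g (pt (x - a * t) t)) setT s measurableT _ D).
- by move=> x; apply: continuous_measurable_fun;
    apply: continuous_monomial_slope; exact: sg.1.
- by move=> x t; apply: le_trans (HK _ _) _; rewrite ler_wpM2r// lerDl.
- by move=> x t; apply: le_trans (HK1 _ _) _; rewrite ler_wpM2r// lerDr.
Qed.

(** Moving the slope multiplies by - t before differentiating, whence the moment
    of the next order. *)
Lemma slope_moment_derive_a k g s a : schwartz g ->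
  is_derive a 1 (fun a => T k g s a) (- T k.+1 (partial 0 g) s a).
Proof.
move=> sg; have sg1 := schwartz_partial 0 sg.
have [K K0 HK] := schwartz_bound_y1 k sg; have [K1 K10 HK1] :=
  schwartz_bound_y1 k.+1 sg1.
have dge0 := @cauchy_density_ge0 R.
have D x t : is_derive x 1 (fun x => t ^+ k * g (pt (s - x * t) t))
    (-1 * (t ^+ k.+1 * partial 0 g (pt (s - x * t) t))).
  have := smooth_derive_line (- t) s 0 t x sg.1.
  rewrite (_ : (fun x => g _) = (fun x => g (pt (s - x * t) t))); last first.
    by apply/funext => z; rewrite mul0r add0r mulNr addrC mulrC.
  have -> : pt (- t * x + s) (0 * x + t) = pt (s - x * t) t.
    by congr pt; ring.
  rewrite mul0r addr0 => H.
  by apply: is_derive_eq; rewrite /GRing.scale /= exprS; ring.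
have -> : - T k.+1 (partial 0 g) s a =
    \int[mu]_(t in setT) (-1 * (t ^+ k.+1 * partial 0 g (pt (s - a * t) t))).
  by rewrite RintegralZl ?mulN1r//; exact: integrable_slope.
apply: (@is_derive_Rintegral_param _ (K + K1) (fun x t =>
  t ^+ k * g (pt (s - x * t) t))
  (fun x t => -1 * (t ^+ k.+1 * partial 0 g (pt (s - x * t) t))) setT a
    measurableT _ D).
- by move=> x; apply: continuous_measurable_fun;
    apply: continuous_monomial_slope; exact: sg.1.
- by move=> x t; apply: le_trans (HK _ _) _; rewrite ler_wpM2r// lerDl.
- move=> x t; rewrite mulN1r normrN; apply: le_trans (HK1 _ _) _.
  by rewrite ler_wpM2r// lerDr.
Qed.

(** The integral over the line of d/dt g (s - a t, t) = (- a d_1 g + d_2 g) is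
    zero. *)
Lemma slope_moment_partial1 g s a : schwartz g ->
  T 0 (partial 1 g) s a = a * T 0 (partial 0 g) s a.
Proof.
move=> sg; have sg0 := schwartz_partial 0 sg; have sg1 := schwartz_partial 1 sg.
have dge0 := @cauchy_density_ge0 R.
have [K K0 HK] := schwartz_bound_y1 0 sg.
have [K1 K10 HK1] := schwartz_bound_y 0 sg0.
have [K2 K20 HK2] := schwartz_bound_y 0 sg1.
have D t : is_derive t 1 (fun t => g (pt (s - a * t) t))
    ((- a) * partial 0 g (pt (s - a * t) t) + partial 1 g (pt (s - a * t) t)).
  have := smooth_derive_line (- a) s 1 0 t sg.1.
  rewrite -slopeE mul1r.
  rewrite (_ : (fun t => g _) = (fun t => g (pt (s - a * t) t)))//.
  by apply/funext => z; rewrite slopeE.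
have z : \int[mu]_(t in setT) ((- a) * partial 0 g (pt (s - a * t) t) +
  partial 1 g (pt (s - a * t) t)) = 0.
  apply: (@Rintegral_derive _ (`|a| * K1 + K2) _ _ _ _ D).
  - move=> t; apply: cvgD; last by apply: continuous_slope; exact: sg1.1.
    by apply: cvgM; [exact: cvg_cst|apply: continuous_slope; exact: sg0.1].
  - move=> t; rewrite 2!mulrDl; apply: le_trans (ler_normD _ _) _; apply: lerD.
      rewrite normrM normrN -!mulrA ler_wpM2l// mulrA.
      by have := HK1 (s - a * t) t; rewrite expr0 mul1r.
    by have := HK2 (s - a * t) t; rewrite expr0 mul1r.
  - apply: (@tends0_of_density _ _ K) => // t.
    by have := HK (s - a * t) t; rewrite expr0 mul1r.
have : T 0 (partial 1 g) s a - a * T 0 (partial 0 g) s a = 0.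
  rewrite -[RHS]z /slope_moment -RintegralZl//; last exact: integrable_slope.
  rewrite -RintegralB//;
    [|exact: integrable_slope|by apply: integrable_scale => //;
    exact: integrable_slope].
  by apply: eq_Rintegral => t _; rewrite !expr0 !mul1r mulNr addrC.
by move/eqP; rewrite subr_eq0 => /eqP.
Qed.

Lemma is_derive_zero (phi : R -> R) x l :
  is_derive x 1 phi l -> (forall x, phi x = 0) -> l = 0.
Proof.
move=> [_ <-] H; rewrite (_ : phi = cst 0); first exact: derive_cst.
by apply/funext => z; rewrite H.
Qed.

Lemma is_derive_quadratic (X Y Z : R -> R) a X' Y' Z' :
  is_derive a 1 X X' -> is_derive a 1 Y Y' -> is_derive a 1 Z Z' ->
  is_derive a 1 (fun a => a ^+ 2 * X a - 2 * a * Y a + Z a)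
    (2 * a * X a + a ^+ 2 * X' - 2 * Y a - 2 * a * Y' + Z').
Proof.
by move=> dX dY dZ; apply: is_derive_eq; rewrite /GRing.scale /=; ring.
Qed.

Lemma is_derive_linear_combination (X Y Z : R -> R) b c s X' Y' Z' :
  is_derive s 1 X X' -> is_derive s 1 Y Y' -> is_derive s 1 Z Z' ->
  is_derive s 1 (fun s => b * X s - c * Y s + Z s) (b * X' - c * Y' + Z').
Proof.
by move=> dX dY dZ; apply: is_derive_eq; rewrite /GRing.scale /=; ring.
Qed.

(** Differentiating the equation of order 0 in a produces first order moments
    that cancel by the s-derivative of the equation of order 1. *)
Lemma slope_moment_equations (f0 f1 f2 : 'rV[R]_2 -> R) :
  schwartz f0 -> schwartz f1 -> schwartz f2 ->
  (forall k s a, (k <= 1)%N ->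
     a ^+ 2 * T k f0 s a - 2 * a * T k f1 s a + T k f2 s a = 0) ->
  (forall s a, T 0 f1 s a = a * T 0 f0 s a) /\
  (forall s a, T 0 f2 s a = a * T 0 f1 s a).
Proof.
move=> s0 s1 s2 E.
have H1 s a : T 0 f1 s a = a * T 0 f0 s a.
  have A0 := slope_moment_derive_a 0 s a s0.
  have A1 := slope_moment_derive_a 0 s a s1.
  have A2 := slope_moment_derive_a 0 s a s2.
  have B0 := slope_moment_derive_s 1 s a s0.
  have B1 := slope_moment_derive_s 1 s a s1.
  have B2 := slope_moment_derive_s 1 s a s2.
  have P := is_derive_quadratic A0 A1 A2.
  have Q := is_derive_linear_combination (a ^+ 2) (2 * a) B0 B1 B2.
  have P0 := is_derive_zero P (fun a => E 0%N s a isT).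
  have Q0 := is_derive_zero Q (fun s => E 1%N s a isT).
  move: P0 Q0; clear.
  move: (T 0 f0 s a) (T 0 f1 s a) (T 1 (partial 0 f0) s a)
    (T 1 (partial 0 f1) s a)
    (T 1 (partial 0 f2) s a) => t0 t1 t2 t3 t4; lra.
split=> // s a; have := E 0%N s a isT; rewrite H1; clear.
move: (T 0 f0 s a) (T 0 f2 s a) => t0 t2; lra.
Qed.

End Moments.

(** * Vanishing moments and Hessians *)

Section Vanishing_moments.
Context {R : realType}.
Local Notation mu := (@lebesgue_measure R).
Local Notation d := cauchy_density.
Local Notation pt := point2.
Local Notation T := slope_moment.
Implicit Types (x y t s a K : R) (g h : 'rV[R]_2 -> R).

Lemma sum_ord2 (F : 'I_2 -> R) : \sum_(i < 2) F i = F 0 + F 1.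
Proof.
by rewrite big_ord_recr big_ord1 /=; congr (F _ + F _); apply: val_inj.
Qed.

Lemma dotE (p q : 'rV[R]_2) : dot p q = p 0 0 * q 0 0 + p 0 1 * q 0 1.
Proof. exact: sum_ord2. Qed.

(** Points of the bundle in coordinates: a unit direction and a base point
    orthogonal to it. *)
Lemma TS1E (p q : 'rV[R]_2) : TS1 (p, q) <->
  q 0 0 ^+ 2 + q 0 1 ^+ 2 = 1 /\ p 0 0 * q 0 0 + p 0 1 * q 0 1 = 0.
Proof.
rewrite /TS1 /= /euclid_norm !dotE -!expr2; split => -[H1 H2]; split => //.
  by rewrite -[LHS]sqr_sqrtr ?H1 ?expr1n// addr_ge0 ?sqr_ge0.
by rewrite H1 sqrtr1.
Qed.

Lemma moment_transformE q f x0 x1 xi0 xi1 :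
  moment_transform q f (pt x0 x1, pt xi0 xi1) =
  \int[mu]_(t in setT)
    (t ^+ q * f (pt (xi0 * t + x0) (xi1 * t + x1)) 0 0 * xi0 * xi0) +
  \int[mu]_(t in setT)
    (t ^+ q * f (pt (xi0 * t + x0) (xi1 * t + x1)) 0 1 * xi0 * xi1) +
  (\int[mu]_(t in setT)
    (t ^+ q * f (pt (xi0 * t + x0) (xi1 * t + x1)) 1 0 * xi1 * xi0) +
  \int[mu]_(t in setT)
    (t ^+ q * f (pt (xi0 * t + x0) (xi1 * t + x1)) 1 1 * xi1 * xi1)).
Proof.
have E t : pt x0 x1 + t *: pt xi0 xi1 = pt (xi0 * t + x0) (xi1 * t + x1).
  by rewrite /pt scalerDr !scalerA addrACA -!scalerDl [t * _]mulrC
    [t * xi1]mulrC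
     [x0 + _]addrC [x1 + _]addrC.
rewrite /moment_transform sum_ord2 !sum_ord2 /= !point2_0 !point2_1.
have H i j (a b : R) :
    \int[mu]_(t in setT) (t ^+ q * f (pt x0 x1 + t *: pt xi0 xi1) i j * a * b) =
    \int[mu]_(t in setT)
      (t ^+ q * f (pt (xi0 * t + x0) (xi1 * t + x1)) i j * a * b).
  by apply: eq_Rintegral => t _; rewrite E.
by rewrite !H.
Qed.

(** The line t |-> (s - a t, t) parametrized by t' = r t + l.  Its moments of
    order 0 or 1 in the parameter t' are combinations of those in t.  For
    r = sqrt (1 + a^2) and l = - a s / r the new parametrization has unit
    speed and its base point is orthogonal to its direction. *)
Lemma ray_moment q g s a r l c : (q <= 1)%N -> schwartz g -> 0 < r ->
  \int[mu]_(t in setT)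
    (t ^+ q * g (pt (- a / r * t + (s + a * l / r)) (r^-1 * t - l / r)) * c) =
  r * (c * ((if q == 0%N then 0 else r) * T 1 g s a +
            (if q == 0%N then 1 else l) * T 0 g s a)).
Proof.
move=> q1 sg r0.
have [K0 K00 H0] := schwartz_bound_y1 0 sg; have [K1 K10 H1] :=
  schwartz_bound_y1 1 sg.
have rn : r != 0 by rewrite gt_eqF.
pose A : R := if q == 0%N then 0 else r.
pose B : R := if q == 0%N then 1 else l.
have qE t : (r * t + l) ^+ q = A * t + B.
  by move: q1; rewrite /A /B; case: (q) => [|[|//]] _ /=;
    rewrite ?expr0 ?expr1 ?mul0r ?add0r.
pose psi t := c * (A * (t ^+ 1 * g (pt (s - a * t) t)) +
  B * (t ^+ 0 * g (pt (s - a * t) t))).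
have i0 := integrable_slope 0 s a sg; have i1 := integrable_slope 1 s a sg.
have psiE : \int[mu]_(t in setT) psi t = c * (A * T 1 g s a + B * T 0 g s a).
  rewrite RintegralZl//; last by apply: integrable_add => //;
    exact: integrable_scale.
  rewrite RintegralD//; [|exact: integrable_scale|exact: integrable_scale].
  by rewrite (RintegralZl A measurableT i1) (RintegralZl B measurableT i0).
rewrite -psiE (@Rintegral_affine _ (`|c| * (`|A| * K1 + `|B| * K0)) r^-1
  (- l / r) psi); first last.
- move=> t; rewrite /psi normrM -mulrA ler_wpM2l// mulrDl;
    apply: le_trans (ler_normD _ _) _.
  by rewrite !(normrM A) !(normrM B) -!mulrA; apply: lerD; apply: ler_wpM2l.
- move=> t; apply: cvgM; first exact: cvg_cst.
  apply: cvgD; (apply: cvgM; first exact: cvg_cst);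
    apply: continuous_monomial_slope; exact: sg.1.
- by rewrite invr_gt0.
rewrite mulrA divff// mul1r; apply: eq_Rintegral => t _.
rewrite /psi expr1 expr0 mul1r.
set tau := r^-1 * t + - l / r.
have -> : t ^+ q = A * tau + B by rewrite -qE /tau; congr (_ ^+ _); field.
have -> : pt (- a / r * t + (s + a * l / r)) (r^-1 * t - l / r) =
  pt (s - a * tau) tau.
  by congr pt; rewrite /tau; field.
ring.
Qed.

Lemma sym_tensor_coeff (f : 'rV[R]_2 -> 'M[R]_2) p : schwartz_sym_tensor f ->
  f p 1 0 = f p 0 1.
Proof. by move=> hf; rewrite -[in LHS](hf.1 p) mxE. Qed.

(** The vanishing of the moments over unit speed lines based at orthogonal
    points, rewritten with the slope parametrization of lines. *)
Lemma slope_equation (f : 'rV[R]_2 -> 'M[R]_2) k s a :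
  schwartz_sym_tensor f ->
  (forall q : nat, (q <= 1)%N ->
     forall p : 'rV[R]_2 * 'rV[R]_2, TS1 p -> moment_transform q f p = 0) ->
  (k <= 1)%N ->
  a ^+ 2 * T k (fun p => f p 0 0) s a - 2 * a * T k (fun p => f p 0 1) s a
    + T k (fun p => f p 1 1) s a = 0.
Proof.
move=> hf If; pose r := Num.sqrt (1 + a ^+ 2).
have r0 : 0 < r by rewrite sqrtr_gt0 add1sqr_gt0.
have rn : r != 0 by rewrite gt_eqF.
have r2 : r ^+ 2 = 1 + a ^+ 2 by rewrite sqr_sqrtr// ltW// add1sqr_gt0.
pose l := - a * s / r.
(* S g is the moment of order q along the unit speed line, up to factors *)
have main q : (q <= 1)%N ->
   (let S g := (if q == 0%N then 0 else r) * T 1 g s a +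
               (if q == 0%N then 1 else l) * T 0 g s a in
   a ^+ 2 * S (fun p => f p 0 0) - 2 * a * S (fun p => f p 0 1) +
     S (fun p => f p 1 1) = 0).
  move=> q1 S.
  have tp : TS1 (pt (s + a * l / r) (- l / r), pt (- a / r) r^-1).
    apply/TS1E; rewrite !point2_0 !point2_1; split.
      by rewrite !exprMn exprVn r2; field; rewrite gt_eqF ?add1sqr_gt0.
    have -> : (s + a * l / r) * (- a / r) + - l / r * r^-1 =
      - a * s / r - l * (1 + a ^+ 2) / r ^+ 2.
      by field.
    by rewrite -r2 mulfK ?expf_neq0// subrr.
  have := If q q1 _ tp; rewrite moment_transformE.
  have Sf i j : schwartz (fun p => f p i j) by exact: hf.2.
  have conv i j c1 c2 :
    \int[mu]_(t in setT)
      (t ^+ q * f (pt (- a / r * t + (s + a * l / r)) (r^-1 * t + - l / r)) i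
      j * c1 * c2) =
     r * (c1 * c2 * S (fun p => f p i j)).
    rewrite -(@ray_moment q (fun p => f p i j) s a r l (c1 * c2))//.
    by apply: eq_Rintegral => t _; rewrite mulNr -!mulrA.
  rewrite !conv.
  rewrite (_ : (fun p => f p 1 0) = (fun p => f p 0 1)); last by apply/funext =>
    p; exact: sym_tensor_coeff.
  move: (S _) (S _) (S _) => S2 S1 S0 H.
  have : r * (a ^+ 2 * S0 - 2 * a * S1 + S2) = 0.
    have -> : r * (a ^+ 2 * S0 - 2 * a * S1 + S2) = r ^+ 2 *
      (r * (- a / r * (- a / r) * S0) + r * (- a / r / r * S1) +
      (r * (r^-1 * (- a / r) * S1) + r * (r^-1 / r * S2))) by field.
    by rewrite H mulr0.
  by move/eqP; rewrite mulf_eq0 (negbTE rn) => /eqP.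
have E0 := main 0%N isT; have E1 := main 1%N isT.
rewrite /= in E0 E1.
case: k => [|[|//]] _; first by move: E0; rewrite !mul0r !add0r !mul1r.
have {}E0 : a ^+ 2 * T 0 (fun p => f p 0 0) s a - 2 * a * T 0 (fun p => f p 0 1)
  s a
    + T 0 (fun p => f p 1 1) s a = 0 by move: E0; rewrite !mul0r !add0r !mul1r.
move: E0 E1; move: (T 1 _ _ _) (T 1 _ _ _) (T 1 _ _ _) => Z Y X E0 E1.
have : r * (a ^+ 2 * X - 2 * a * Y + Z) +
  l * (a ^+ 2 * T 0 (fun p => f p 0 0) s a - 2 * a * T 0 (fun p => f p 0 1) s a
    + T 0 (fun p => f p 1 1) s a) = 0 by rewrite -[RHS]E1; ring.
by rewrite E0 mulr0 addr0 => /eqP; rewrite mulf_eq0 (negbTE rn) => /eqP.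
Qed.

Lemma slope_xray_injective g h : schwartz g -> schwartz h ->
  (forall s a, T 0 g s a = T 0 h s a) -> forall p, g p = h p.
Proof.
move=> sg sh E p.
have [K1 K10 H1] := schwartz_bound 0 0 sg.
have [K2 K20 H2] := schwartz_bound 0 0 sh.
have d0 := @cauchy_density_ge0 R; have d1 := @cauchy_density_le1 R.
have H : forall x y, g (pt x y) - h (pt x y) = 0.
  apply: (@xray_injective R (K1 + K2) (fun x y => g (pt x y) - h (pt x y))).
  - by move=> z; apply: cvgB;
      [exact: (smooth_continuous2 sg.1)|exact: (smooth_continuous2 sh.1)].
  - move=> x y; apply: le_trans (ler_normB _ _) _.
    have := H1 x y; have := H2 x y; rewrite !expr0 !mul1r => h2 h1.
    apply: (@le_trans _ _ ((K1 + K2) * (d x * d x) * (d y * d y))).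
      by rewrite !mulrDl; apply: lerD.
    rewrite ler_wpM2r ?mulr_ge0// ler_wpM2l ?addr_ge0//.
    by rewrite -[leRHS]mulr1 ler_wpM2l.
  - move=> s a; have := E s a; rewrite /slope_moment => e.
    have i1 := integrable_slope 0 s a sg; have i2 := integrable_slope 0 s a sh.
    transitivity (\int[mu]_(t in setT) (t ^+ 0 * g (pt (s - a * t) t) -
      t ^+ 0 * h (pt (s - a * t) t))).
      by apply: eq_Rintegral => t _; rewrite !expr0 !mul1r.
    by rewrite RintegralB// e subrr.
by rewrite (point2E p); apply/eqP; rewrite -subr_eq0 H.
Qed.

Lemma hessian_potential (f : 'rV[R]_2 -> 'M[R]_2) : schwartz_sym_tensor f ->
  (forall q : nat, (q <= 1)%N ->
     forall p : 'rV[R]_2 * 'rV[R]_2, TS1 p -> moment_transform q f p = 0) ->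
  exists v : 'rV[R]_2 -> R,
     [/\ smooth v, f = hessian v, vanishes_at_infinity v &
         forall i : 'I_2, vanishes_at_infinity (partial i v)].
Proof.
move=> hf If.
have [s0 s1 s2] : [/\ schwartz (fun p => f p 0 0), schwartz (fun p => f p 0 1) &
   schwartz (fun p => f p 1 1)] by split; exact: hf.2.
have [E01 E12] :=
  slope_moment_equations s0 s1 s2 (fun k s a k1 => slope_equation s a hf If k1).
have ds g h : schwartz g -> schwartz h ->
  (forall s a, T 0 h s a = a * T 0 g s a) ->
    forall s a, T 0 (partial 1 g) s a = T 0 (partial 0 h) s a.
  move=> sg sh E s a; rewrite slope_moment_partial1//.
  have D1 := slope_moment_derive_s 0 s a sg.
  have [_ <-] := slope_moment_derive_s 0 s a sh.
  rewrite (_ : (fun s => T 0 h s a) = (fun s => a * T 0 g s a)); last first.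
    by apply/funext => z; exact: E.
  have D : is_derive s 1 (fun s => a * T 0 g s a) (a * T 0 (partial 0 g) s a)
    by apply: is_derive_eq.
  by have [_ ->] := D.
have cl g h : schwartz g -> schwartz h ->
  (forall s a, T 0 h s a = a * T 0 g s a) ->
    forall p, partial 1 g p = partial 0 h p.
  move=> sg sh E; apply: slope_xray_injective;
    [exact: schwartz_partial|exact: schwartz_partial|].
  exact: ds.
have [U1 [sU1 U10 U11]] := closed_schwartz_form_exact s0 s1 (cl _ _ s0 s1 E01).
have [U2 [sU2 U20 U21]] := closed_schwartz_form_exact s1 s2 (cl _ _ s1 s2 E12).
have [V [sV V0 V1]] : exists V,
  [/\ schwartz V, partial 0 V = U1 & partial 1 V = U2].
  by apply: closed_schwartz_form_exact => // p; rewrite U11 U20.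
exists V; split.
- exact: sV.1.
- apply/funext => p; apply/matrixP => i j; rewrite mxE.
  case: (ord2_eq i) => ->; case: (ord2_eq j) => ->;
    rewrite ?V0 ?V1 ?U10 ?U11 ?U20 ?U21//.
  exact: sym_tensor_coeff.
- exact: schwartz_vanishes.
- by move=> i; apply: schwartz_vanishes; case: (ord2_eq i) => ->;
    rewrite ?V0 ?V1.
Qed.

(** If f decays like t^-4, its primitive F tending to 0 satisfies t F (t) -> 0:
    indeed t^2 F (t) is bounded, F (t) being the integral of f over either
    half-line bounded by t. *)
Lemma weighted_primitive_tends0 (F f : R -> R) K : continuous f ->
  (forall t, `|f t| <= K * d t * d t) ->
    (forall t, `|t ^+ 2 * f t| <= K * d t) ->
  (forall t, is_derive t 1 F (f t)) -> tends0_infty F ->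
    tends0_infty (fun t => t * F t).
Proof.
move=> cf fK fK2 dF F0.
have K0 : 0 <= K by exact: le_density_cst_ge0 fK2.
have fK1 t : `|f t| <= K * d t by apply: le_density_sqr.
have fi (B : set R) : measurable B -> mu.-integrable B (EFin \o f).
  by move=> mB; apply: (@integrable_le_density _ K) => //;
    exact: continuous_measurable_fun.
have bnd (B : set R) t : measurable B -> (forall s, B s -> `|t| <= `|s|) ->
    `|t| ^+ 2 * `|\int[mu]_(s in B) f s| <= K * cauchy_mass.
  move=> mB HB; apply: Rintegral_le_density => //; first exact: fi.
  move=> s /HB ts; apply: le_trans (fK2 s); rewrite normrM normrX ler_wpM2r//.
  by apply: lerXn2r => //; rewrite nnegrE.
apply: (@tends0_of_bound _ _ (K * cauchy_mass)) => t.
rewrite normrM mulrA -expr2; have [t0|t0] := leP t 0.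
  rewrite -(@primitiveNy _ K F f t cf fK dF F0).
  apply: bnd; first exact: measurable_itv.
  by move=> s /=; rewrite in_itv /= => st; rewrite !ler0_norm; lra.
have := @Rintegral_compl _ K f t cf fK1.
rewrite (@Rintegral_derive _ K F f cf fK dF F0)
  (@primitiveNy _ K F f t cf fK dF F0).
move=> /eqP; rewrite eq_sym addr_eq0 => /eqP ->; rewrite normrN.
apply: bnd; first exact: measurable_itv.
by move=> s /=; rewrite in_itv /= andbT => st; rewrite !ger0_norm; lra.
Qed.

Lemma is_derive_combination (X Y : R -> R) b c t X' Y' :
  is_derive t 1 X X' -> is_derive t 1 Y Y' ->
  is_derive t 1 (fun t => b * X t + c * Y t) (b * X' + c * Y').
Proof.
by move=> dX dY; apply: is_derive_eq; rewrite /GRing.scale /=; ring.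
Qed.

Lemma is_derive_id_mul_sub (X Y : R -> R) t X' :
  is_derive t 1 X X' -> is_derive t 1 Y (X t) ->
  is_derive t 1 (fun t => t * X t + -1 * Y t) (t * X').
Proof.
by move=> dX dY; apply: is_derive_eq; rewrite /GRing.scale /=; ring.
Qed.

Lemma moment_transform_hessian (f : 'rV[R]_2 -> 'M[R]_2)
    (v : 'rV[R]_2 -> R) q p :
  schwartz_sym_tensor f -> smooth v -> f = hessian v ->
  vanishes_at_infinity v ->
  (forall i : 'I_2, vanishes_at_infinity (partial i v)) ->
  (q <= 1)%N -> TS1 p -> moment_transform q f p = 0.
Proof.
move=> hf sv fv v0 dv0; case: p => x xi q1; rewrite (point2E x) (point2E xi).
move: (x 0 0) (x 0 1) (xi 0 0) (xi 0 1) => {x xi} x0 x1 xi0 xi1.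
move=> /TS1E; rewrite !point2_0 !point2_1 => -[n1 orth].
pose L t : 'rV[R]_2 := pt (xi0 * t + x0) (xi1 * t + x1).
have Lsq t : (xi0 * t + x0) ^+ 2 + (xi1 * t + x1) ^+ 2 =
  t ^+ 2 + (x0 ^+ 2 + x1 ^+ 2).
  transitivity ((xi0 ^+ 2 + xi1 ^+ 2) * t ^+ 2 + 2 * t * (x0 * xi0 + x1 * xi1) +
    (x0 ^+ 2 + x1 ^+ 2)).
    by ring.
  by rewrite n1 orth; ring.
have Lbound g k : schwartz g -> exists2 K, 0 <= K & forall t,
  `|t ^+ k * g (L t)| <= K * d t * d t.
  move=> sg; have [K K0 HK] := schwartz_decay (k + 2) sg; exists K => // t.
  have t0 := add1sqr_gt0 t.
  have -> : K * d t * d t = K / (1 + t ^+ 2) ^+ 2 by rewrite /cauchy_density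
    [in RHS]expr2 invfM mulrA.
  rewrite ler_pdivlMr ?exprn_gt0//.
  apply: le_trans (HK (xi0 * t + x0) (xi1 * t + x1)).
  rewrite normrM normrX mulrAC; apply: ler_wpM2r => //.
  apply: (@le_trans _ _ ((1 + t ^+ 2) ^+ (k + 2))).
    by rewrite exprD ler_wpM2r ?exprn_ge0 ?(ltW t0)// expr_le_add1sqr.
  have xx := sqr_ge0 x0; have yy := sqr_ge0 x1.
  by apply: lerXn2r; rewrite ?nnegrE -?addrA ?Lsq; lra.
have Lvan g : vanishes_at_infinity g -> tends0_infty (fun t => g (L t)).
  move=> vg e e0; have [M HM] := vg e e0; exists M => t Mt; apply: HM.
  apply: le_trans Mt _; rewrite -sqrtr_sqr ler_wsqrtr// dotE point2_0 point2_1
    -!expr2 Lsq.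
  by rewrite lerDl addr_ge0 ?sqr_ge0.
have cL g : smooth g -> continuous (fun t => g (L t)) by move=> sg;
  exact: smooth_continuous_line.
(* phi is v along the line L, with first and second derivatives phi1, phi2 *)
pose phi t := v (L t).
pose phi1 t := xi0 * partial 0 v (L t) + xi1 * partial 1 v (L t).
pose phi2 t := f (L t) 0 0 * xi0 * xi0 + f (L t) 0 1 * xi0 * xi1 +
   (f (L t) 1 0 * xi1 * xi0 + f (L t) 1 1 * xi1 * xi1).
have dphi t : is_derive t 1 phi (phi1 t) by exact: smooth_derive_line.
have fE i j p : f p i j = partial i (partial j v) p by rewrite fv mxE.
have dphi1 t : is_derive t 1 phi1 (phi2 t).
  have D0 := smooth_derive_line xi0 x0 xi1 x1 t (smooth_partial 0 sv).
  have D1 := smooth_derive_line xi0 x0 xi1 x1 t (smooth_partial 1 sv).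
  rewrite (_ : phi2 t =
    xi0 * (xi0 * partial 0 (partial 0 v) (L t) +
    xi1 * partial 1 (partial 0 v) (L t)) +
    xi1 * (xi0 * partial 0 (partial 1 v) (L t) + xi1 * partial 1 (partial 1 v)
      (L t))).
    exact: (is_derive_combination xi0 xi1 D0 D1).
  rewrite /phi2 !fE; clear.
  move: (partial 0 (partial 0 v) _) (partial 0 (partial 1 v) _)
    (partial 1 (partial 0 v) _) (partial 1 (partial 1 v) _) => A B C D; ring.
have Sf i j : schwartz (fun p => f p i j) by exact: hf.2.
have cphi2 : continuous phi2.
  have c i j (a b : R) : continuous (fun t => f (L t) i j * a * b).
    move=> t; apply: cvgM; last exact: cvg_cst.
    apply: cvgM; last exact: cvg_cst.
    exact: (cL (fun p => f p i j) (Sf i j).1).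
  by move=> t; apply: cvgD; apply: cvgD; exact: c.
have phi2K k : exists2 K, 0 <= K & forall t, `|t ^+ k * phi2 t| <=
  K * d t * d t.
  have [K1 K10 H1] := Lbound _ k (Sf 0 0).
  have [K2 K20 H2] := Lbound _ k (Sf 0 1).
  have [K3 K30 H3] := Lbound _ k (Sf 1 0).
  have [K4 K40 H4] := Lbound _ k (Sf 1 1).
  exists (K1 * `|xi0 * xi0| + K2 * `|xi0 * xi1| +
    (K3 * `|xi1 * xi0| + K4 * `|xi1 * xi1|)).
    by rewrite !addr_ge0 ?mulr_ge0.
  move=> t.
  have b i j (a b : R) K : `|t ^+ k * f (L t) i j| <= K * d t * d t ->
     `|t ^+ k * (f (L t) i j * a * b)| <= K * `|a * b| * d t * d t.
    move=> H.
    have -> : t ^+ k * (f (L t) i j * a * b) =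
      t ^+ k * f (L t) i j * (a * b) by ring.
    rewrite normrM.
    have -> : K * `|a * b| * d t * d t = K * d t * d t * `|a * b| by ring.
    exact: ler_wpM2r.
  rewrite /phi2 !mulrDr !mulrDl.
  apply: le_trans (ler_normD _ _) _; apply: lerD.
    by apply: le_trans (ler_normD _ _) _; apply: lerD; apply: b.
  by apply: le_trans (ler_normD _ _) _; apply: lerD; apply: b.
have int i j (a b : R) : mu.-integrable setT
  (EFin \o (fun t => t ^+ q * f (L t) i j * a * b)).
  have [K K0 HK] := Lbound _ q (Sf i j).
  rewrite (_ : (fun t => _) = (fun t => (a * b) * (t ^+ q * f (L t) i j)));
    last first.
    by apply/funext => t; ring.
  apply: integrable_scale => //; apply: (@integrable_le_density _ K) => //.
    apply: continuous_measurable_fun => t; apply: cvgM;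
      first exact: exprn_continuous.
    exact: (cL (fun p => f p i j) (Sf i j).1).
  by move=> t _; apply: le_density_sqr.
rewrite moment_transformE -/(L _).
rewrite -[X in X + _]RintegralD// -[X in _ + X]RintegralD// -RintegralD//;
  [|exact: integrable_add..].
transitivity (\int[mu]_(t in setT) (t ^+ q * phi2 t)).
  by apply: eq_Rintegral => t _; rewrite /phi2 /L; ring.
have [K K0 H0] := phi2K 0%N; have [K1 K10 H1] := phi2K q; have [K2 K20 H2] :=
  phi2K 2%N.
have d0 := @cauchy_density_ge0 R.
have phi1_0 : tends0_infty phi1.
  by apply: tends0_infty_add; apply: tends0_infty_scale; apply: Lvan.
case: q q1 H1 {int} => [|[|//]] _ H1.
  apply: (@Rintegral_derive _ K1 phi1) => //.
  - by move=> t; apply: cvgM; [exact: exprn_continuous|exact: cphi2].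
  - by move=> t; rewrite expr0 mul1r.
have tphi : tends0_infty (fun t => t * phi1 t).
  apply: (@weighted_primitive_tends0 phi1 phi2 (K + K2)) => //.
  - move=> t; apply: (@le_trans _ _ (K * d t * d t)); first by have := H0 t;
      rewrite expr0 mul1r.
    by rewrite !ler_wpM2r// lerDl.
  - move=> t; apply: (@le_trans _ _ (K2 * d t)); first by apply: le_density_sqr.
    by rewrite ler_wpM2r// lerDr.
apply: (@Rintegral_derive _ K1 (fun t => t * phi1 t + -1 * phi t)) => //.
- by move=> t; apply: cvgM; [exact: exprn_continuous|exact: cphi2].
- by move=> t; rewrite expr1; exact: (is_derive_id_mul_sub (dphi1 t) (dphi t)).
- by apply: tends0_infty_add => //; apply: tends0_infty_scale; exact: Lvan.
Qed.

End Vanishing_moments.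

Theorem theorem9 (R : realType) (f : 'rV[R]_2 -> 'M[R]_2)
    (hf : schwartz_sym_tensor f) :
  (forall q : nat, (q <= 1)%N ->
     forall p : 'rV[R]_2 * 'rV[R]_2, TS1 p -> moment_transform q f p = 0) <->
  (exists v : 'rV[R]_2 -> R,
     [/\ smooth v,
         f = hessian v,
         vanishes_at_infinity v &
         forall i : 'I_2, vanishes_at_infinity (partial i v)]).
Proof.
split; first exact: hessian_potential.
case=> v [sv fv v0 dv0] q q1 p.
exact: moment_transform_hessian.
Qed.
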